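(* Let $n\ge2$, $T=\{1,\dots,n\}$, $S=\{n+1,\dots,2n\}$, and let $so(2n,\mathbb C)$ act on $\mathcal A=\mathbb C[x_1,\dots,x_{2n}]$ by the representation attached to $(S,T)$ described in the context. Let $\Delta=-\sum_{i=1}^nx_i\partial_{x_{n+i}}$, $\eta=\sum_{i=1}^nx_{n+i}\partial_{x_i}$, $\mathcal H_{\langle k\rangle}=\{f\in\mathcal A_{\langle k\rangle}\mid\Delta(f)=0\}$ and $\mathcal H'_{\langle k\rangle}=\{f\in\mathcal A_{\langle k\rangle}\mid\eta(f)=0\}$. If $k\ge0$, then $\mathcal A_{\langle k\rangle}=\mathcal H'_{\langle k\rangle}\oplus\Delta\mathcal A_{\langle k+2\rangle}$, and $\mathcal H'_{\langle k\rangle}$ is an irreducible highest weight module with highest weight $k\lambda_{n-1}-(k+2)\lambda_n$ and a corresponding highest weight vector $x_{2n}^k$. Moreover, the set $$\Big\{\prod_{t=1}^nx_{n+t}^{k_t}\prod_{1\le i<j\le n}(x_ix_{n+j}-x_jx_{n+i})^{k_{i,j}}\ \Big|\ k_t,k_{i,j}\in\mathbb N;\ \sum_{t=1}^nk_t=k;\ k_{i,j}k_t=0\text{ for }i<j<t;\ k_{i,j}k_{i_1,j_1}=0\text{ for }i<i_1\text{ and }j>j_1\Big\}$$ forms a basis of $\mathcal H'_{\langle k\rangle}$. If $k<0$, then $\mathcal A_{\langle k\rangle}=\mathcal H_{\langle k\rangle}\oplus\eta\mathcal A_{\langle k-2\rangle}$, and $\mathcal H_{\langle k\rangle}$ is an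 irreducible highest weight module with highest weight $-k\lambda_{n-1}+(k-2)\lambda_n$ and a corresponding highest weight vector $x_n^{-k}$. Moreover, the set $$\Big\{\prod_{t=1}^nx_{t}^{k_t}\prod_{1\le i<j\le n}(x_ix_{n+j}-x_jx_{n+i})^{k_{i,j}}\ \Big|\ k_t,k_{i,j}\in\mathbb N;\ \sum_{t=1}^nk_t=-k;\ k_{i,j}k_t=0\text{ for }i<j<t;\ k_{i,j}k_{i_1,j_1}=0\text{ for }i<i_1\text{ and }j>j_1\Big\}$$ forms a basis of $\mathcal H_{\langle k\rangle}$.
   Context: $\mathbb N$ denotes the nonnegative integers; $E_{i,j}$ are matrix units of size $2n$. $$\mathcal G=so(2n,\mathbb C)=\sum_{i,j=1}^n\mathbb C(E_{i,j}-E_{n+j,n+i})+\sum_{1\le i<j\le n}[\mathbb C(E_{i,n+j}-E_{j,n+i})+\mathbb C(E_{n+j,i}-E_{n+i,j})].$$ Cartan subalgebra $H=\sum_{i=1}^n\mathbb C(E_{i,i}-E_{n+i,n+i})$; positive root vectors $E_{i,j}-E_{n+j,n+i}$, $E_{i,n+j}-E_{j,n+i}$ ($1\le i<j\le n$), spanning $\mathcal G_+$. With $h_i=E_{i,i}-E_{n+i,n+i}-E_{i+1,i+1}+E_{n+i+1,n+i+1}$ ($1\le i\le n-1$) and $h_n=E_{n-1,n-1}-E_{2n-1,2n-1}+E_{n,n}-E_{2n,2n}$, the fundamental weights $\lambda_1,\dots,\lambda_n\in H^*$ satisfy $\lambda_i(h_j)=\delta_{i,j}$. The representation attached to a partition $(S,T)$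 of $\{1,\dots,2n\}$ is the restriction to $\mathcal G$ of the representation of $gl(2n,\mathbb C)$ on $\mathcal A$: $E_{i,j}=x_i\partial_{x_j}$ if $i,j\in S$; $-x_ix_j$ if $i\in S,j\in T$; $\partial_{x_i}\partial_{x_j}$ if $i\in T,j\in S$; $-x_j\partial_{x_i}-\delta_{i,j}$ if $i,j\in T$. $\mathcal A_{\langle k\rangle}=\mathrm{Span}\{x^\alpha\mid\alpha\in\mathbb N^{2n},\sum_{i\in S}\alpha_i-\sum_{i\in T}\alpha_i=k\}$. The operators $\Delta,\eta$ commute with $\mathcal G$, $\Delta\mathcal A_{\langle k\rangle}\subset\mathcal A_{\langle k-2\rangle}$, $\eta\mathcal A_{\langle k\rangle}\subset\mathcal A_{\langle k+2\rangle}$. A highest weight module is one generated by a nonzero $v$ with $H.v\subset\mathbb Cv$ and $\mathcal G_+.v=0$ (a highest weight vector), whose weight is the highest weight. *)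

(* Defs.v *)
From HB Require Import structures.
From mathcomp Require Import all_boot all_order all_algebra.
From mathcomp Require Import complex reals mpoly.

Set Implicit Arguments.
Unset Strict Implicit.
Unset Printing Implicit Defensive.

Import Order.TTheory GRing.Theory Num.Theory.
Local Open Scope ring_scope.

(* Subspaces of a (possibly infinite-dimensional) vector space are Prop-valued
   predicates, since {vspace _} covers only finite dimension. *)
Section LinearAlgebra.
Variables (C : fieldType) (V : lmodType C).
Implicit Types (X M U W : V -> Prop).

Definition subspace W : Prop :=
  W 0 /\ (forall (a : C) (f g : V), W f -> W g -> W (a *: f + g)).

Definition lspan X (f : V) : Prop :=
  exists (s : seq V) (c : V -> C),
    (forall b, b \in s -> X b) /\ f = \sum_(b <- s) c b *: b.

Definition lin_indep X : Prop :=
  forall (s : seq V) (c : V -> C),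
    uniq s -> (forall b, b \in s -> X b) ->
    \sum_(b <- s) c b *: b = 0 -> forall b, b \in s -> c b = 0.

Definition is_basis X M : Prop :=
  (forall f, M f <-> lspan X f) /\ lin_indep X.

Definition image_of (D : V -> V) M (f : V) : Prop :=
  exists g, M g /\ f = D g.

Definition direct_sum M U W : Prop :=
  (forall f, M f <-> exists u w, [/\ U u, W w & f = u + w]) /\
  (forall f, U f -> W f -> f = 0).

End LinearAlgebra.

(* The indices 1, .., 2n are the elements of 'I_(n + n): i is represented by
   lshift n i and n + i by rshift n i, for i : 'I_n (counted from 0). *)
Section LieAlgebra.
Variables (C : fieldType) (n : nat).
Local Notation gl := 'M[C]_(n + n).
Local Notation lo i := (lshift n i).
Local Notation hi i := (rshift n i).

Definition Emx (a b : 'I_(n + n)) : gl := delta_mx a b.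

Definition vecA (i j : 'I_n) : gl := Emx (lo i) (lo j) - Emx (hi j) (hi i).
Definition vecB (i j : 'I_n) : gl := Emx (lo i) (hi j) - Emx (lo j) (hi i).
Definition vecC (i j : 'I_n) : gl := Emx (hi j) (lo i) - Emx (hi i) (lo j).

Definition so : {vspace gl} :=
  (\sum_(i < n) \sum_(j < n) <[vecA i j]>
   + \sum_(i < n) \sum_(j < n | (i < j)%N) (<[vecB i j]> + <[vecC i j]>))%VS.

Definition cartan : {vspace gl} := (\sum_(i < n) <[vecA i i]>)%VS.

Definition so_pos : {vspace gl} :=
  (\sum_(i < n) \sum_(j < n | (i < j)%N) (<[vecA i j]> + <[vecB i j]>))%VS.

(* ordS i is i + 1 when i is not the last index; for the last index, ord_pred i
   is n - 1 in 1-based numbering. *)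
Definition coroot (i : 'I_n) : gl :=
  if (i.+1 < n)%N then vecA i i - vecA (ordS i) (ordS i)
  else vecA (ord_pred i) (ord_pred i) + vecA i i.

Definition weight : Type := 'Hom(subvs_of cartan, C^o).

(* The basis of weights dual to the coroots; see fund_weightP below. *)
Definition fund_weight (i : 'I_n) : 'Hom(subvs_of cartan, C^o) :=
  linfun (coord [tuple coroot j | j < n] i \o vsval : subvs_of cartan -> C^o).

Lemma coroot_cartan (i : 'I_n) : coroot i \in cartan.
Proof.
have vA j : vecA j j \in cartan.
  by rewrite /cartan memvE (sumv_sup j isT) // subvv.
by rewrite /coroot; case: ifP => _; [apply: memvB | apply: memvD].
Qed.

End LieAlgebra.

Section FundamentalWeights.
Variables (C : numFieldType) (n : nat).
Hypothesis hn : (1 < n)%N.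

Let psum (i : 'I_n) (M : 'M[C]_(n + n)) : C :=
  \sum_(l < n | (l <= i)%N) M (lshift n l) (lshift n l).

Let psumA (i j : 'I_n) : psum i (vecA C j j) = (j <= i)%N%:R.
Proof.
have dE (l : 'I_n) :
    vecA C j j (lshift n l) (lshift n l) = (if l == j then 1 else 0).
  rewrite !mxE eq_lrshift /= subr0 andbb (inj_eq (@lshift_inj _ _)).
  by case: eqP.
rewrite /psum (eq_bigr _ (fun l _ => dE l)).
rewrite -big_mkcondr /=; case: (leqP j i) => ji.
  rewrite (big_pred1 j) // => l /=.
  by case: eqP => [->|]; rewrite ?ji // andbF.
by rewrite big_pred0 // => l; case: eqP => [->|]; rewrite ?andbF // leqNgt ji.
Qed.

Let psumD i M P : psum i (M + P) = psum i M + psum i P.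
Proof. by rewrite /psum -big_split; apply: eq_bigr => l _; rewrite mxE. Qed.

Let psumB i M P : psum i (M - P) = psum i M - psum i P.
Proof. by rewrite /psum -sumrB; apply: eq_bigr => l _; rewrite !mxE. Qed.

Let psum_coroot (i j : 'I_n) : psum i (coroot C j) =
  if (j.+1 < n)%N then (j == i)%:R else (n.-2 <= i)%N%:R + (n.-1 <= i)%N%:R.
Proof.
rewrite /coroot; case: (ltnP j.+1 n) => hj.
  rewrite psumB !psumA /= modn_small //.
  by rewrite -val_eqE /=; case: (ltngtP j i) => _; rewrite ?subrr ?subr0.
have jE : (j : nat) = n.-1.
  apply/eqP; rewrite eqn_leq; apply/andP.
  by split; rewrite -ltnS prednK ?ltn_ord // ltnW.
rewrite psumD !psumA /= jE.
suff -> : ((n.-1 + n).-1 %% n = n.-2)%N by [].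
case: (n) hn => [|[|m]] //= _.
by rewrite ?addnS ?addSn /= -!addnS modnDr modn_small.
Qed.

Lemma coroot_free : free [tuple coroot C j | j < n].
Proof.
apply/freeP => c c0.
have S0 i : \sum_(j < n) c j * psum i (coroot C j) = 0.
  transitivity (psum i (\sum_(j < n) c j *: [tuple coroot C j | j < n]`_j)).
    rewrite /psum; under [RHS]eq_bigr => l _ do rewrite summxE.
    rewrite exchange_big; apply: eq_bigr => j _; rewrite mulr_sumr.
    by apply: eq_bigr => l _; rewrite -tnth_nth tnth_mktuple mxE.
  by rewrite c0 /psum big1 // => l _; rewrite mxE.
have n0 : (0 < n)%N by apply: ltnW.
have nS : (n.-1 < n)%N by rewrite ltn_predL.
pose q := Ordinal nS.
have qP (j : 'I_n) : (j.+1 < n)%N = (j != q).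
  by rewrite -ltn_predRL ltn_neqAle -[(j <= _)%N]ltnS prednK // ltn_ord andbT.
have cq : c q = 0.
  move: (S0 q); rewrite (bigD1 q) //= big1 => [|j jq].
    rewrite psum_coroot qP eqxx /= leq_pred leqnn addr0 => /eqP.
    by rewrite mulf_eq0 (_ : 1 + 1 = 2%:R :> C) // pnatr_eq0 orbF => /eqP.
  by rewrite psum_coroot qP jq (negbTE jq) mulr0.
move=> i; have [->//|iq] := eqVneq i q.
move: (S0 i); rewrite (bigD1 i) //= big1 => [|j ji].
  by rewrite psum_coroot qP iq eqxx mulr1 addr0.
have [->|jq] := eqVneq j q; first by rewrite cq mul0r.
by rewrite psum_coroot qP jq (negbTE ji) mulr0.
Qed.

Lemma fund_weightP (i j : 'I_n) :
  fund_weight C i (vsproj (cartan C n) (coroot C j)) = (i == j)%:R.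
Proof.
rewrite lfunE /= vsprojK ?coroot_cartan //.
have -> : coroot C j = [tuple coroot C j | j < n]`_j.
  by rewrite -tnth_nth tnth_mktuple.
by rewrite coord_free ?coroot_free // eq_sym.
Qed.

End FundamentalWeights.

Section Representation.
Variables (C : fieldType) (N : nat).
Variable T : {set 'I_N}.
Local Notation A := {mpoly C[N]}.

(* S is the complement of T. *)
Definition Eact (i j : 'I_N) (f : A) : A :=
  if i \in T then
    if j \in T then - ('X_j * mderiv i f) - (i == j)%:R *: f
    else mderiv i (mderiv j f)
  else
    if j \in T then - ('X_i * 'X_j * f)
    else 'X_i * mderiv j f.

Definition glact (M : 'M[C]_N) (f : A) : A :=
  \sum_(i < N) \sum_(j < N) M i j *: Eact i j f.

Definition graded (k : int) : A -> Prop :=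
  lspan (fun f : A => exists m : 'X_{1..N},
    (\sum_(i | i \notin T) (m i)%:Z - \sum_(i | i \in T) (m i)%:Z = k)
    /\ f = 'X_[m]).

End Representation.

Section Modules.
Variables (C : fieldType) (n : nat).
Variable T : {set 'I_(n + n)}.
Local Notation A := {mpoly C[n + n]}.
Implicit Types (M W : A -> Prop).

Definition so_submodule W : Prop :=
  subspace W /\ (forall g f, g \in so C n -> W f -> W (glact T g f)).

Definition so_generated (v f : A) : Prop :=
  forall W, so_submodule W -> W v -> W f.

Definition irreducible_module M : Prop :=
  [/\ so_submodule M, (exists f, M f /\ f <> 0) &
      forall W, so_submodule W -> (forall f, W f -> M f) ->
        (forall f, W f -> f = 0) \/ (forall f, M f -> W f)].

Definition highest_weight_vector (mu : weight C n) (v : A) : Prop :=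
  [/\ v <> 0,
      forall h : subvs_of (cartan C n), glact T (vsval h) v = mu h *: v &
      forall g, g \in so_pos C n -> glact T g v = 0].

Definition highest_weight_module (mu : weight C n) (v : A) M : Prop :=
  [/\ so_submodule M, highest_weight_vector mu v &
      forall f, M f <-> so_generated v f].

End Modules.

Section Setting.
Variables (C : fieldType) (n : nat).
Local Notation A := {mpoly C[n + n]}.
Local Notation lo i := (lshift n i).
Local Notation hi i := (rshift n i).

Definition Tlow : {set 'I_(n + n)} := [set lo i | i : 'I_n].

Definition Delta_op (f : A) : A := - \sum_(i < n) 'X_(lo i) * mderiv (hi i) f.
Definition eta_op (f : A) : A := \sum_(i < n) 'X_(hi i) * mderiv (lo i) f.

Definition Agr (k : int) : A -> Prop := graded Tlow k.
Definition Hgr (k : int) (f : A) : Prop := Agr k f /\ Delta_op f = 0.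
Definition Hgr' (k : int) (f : A) : Prop := Agr k f /\ eta_op f = 0.

(* The values kk i j are used only for i < j. *)
Definition standard_monomials (z : 'I_n -> A) (d : int) (f : A) : Prop :=
  exists (kt : 'I_n -> nat) (kk : 'I_n -> 'I_n -> nat),
    [/\ (\sum_(t < n) kt t)%N%:Z = d,
        forall i j t : 'I_n, (i < j)%N -> (j < t)%N -> (kk i j * kt t = 0)%N,
        forall i j i1 j1 : 'I_n, (i < j)%N -> (i1 < j1)%N ->
          (i < i1)%N -> (j1 < j)%N -> (kk i j * kk i1 j1 = 0)%N &
        f = (\prod_(t < n) z t ^+ kt t)
            * \prod_(i < n) \prod_(j < n | (i < j)%N)
                ('X_(lo i) * 'X_(hi j) - 'X_(lo j) * 'X_(hi i)) ^+ kk i j].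

End Setting.

Lemma ltn_last n : (1 < n)%N -> (n.-1 < n)%N.
Proof. by case: n. Qed.

Lemma ltn_penult n : (1 < n)%N -> (n.-2 < n)%N.
Proof. by case: n => [|[]]. Qed.

Definition idx_last n (hn : (1 < n)%N) : 'I_n := Ordinal (ltn_last hn).
Definition idx_penult n (hn : (1 < n)%N) : 'I_n := Ordinal (ltn_penult hn).

(* Main.v *)
Require Import Defs.
From HB Require Import structures.
From mathcomp Require Import all_boot all_order all_algebra.
From mathcomp Require Import complex reals mpoly.
From mathcomp Require boolp.
From mathcomp Require Import zify ring.

Set Implicit Arguments.
Unset Strict Implicit.
Unset Printing Implicit Defensive.

Import Order.TTheory GRing.Theory Num.Theory.
Local Open Scope ring_scope.

(** Write [u_i, v_i] for the variables [x_i, x_{n+i}], [D_ij] for the minor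
[u_i v_j - u_j v_i] and [D*_ij] for the same minor in the partial derivatives.
Up to sign and constants, [so(2n)] acts by the [u_j d/du_i + v_j d/dv_i], the
multiplications by [D_ij] and the operators [D*_ij]. The operators [eta],
[-Delta] generate an [sl2] commuting with this action, which gives the direct
sum for [k >= 0]. Capelli's identity
[sum_{i<j} D_ij D*_ij = E_u (E_v + 1) + Delta eta], with [E_u], [E_v] the Euler
operators, shows that the kernel of [eta] in degree [k >= 0] is generated under
multiplication by the [D_ij] by the monomials of degree [k] in the [v_i], and
that every nonzero submodule contains [v_n^k]. The minors and the [v_t]
together satisfy the Pluecker relations, whence spanning by straightening; the
leading monomials of standard products are distinct, whence independence. The
case [k < 0] follows through the automorphism [u_i -> -v_i], [v_i -> u_i], which
commutes with [so(2n)] and exchanges [eta] and [Delta]. *)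

(** * Subspaces and linear spans given as predicates *)

Section Subspaces.
Variables (C : fieldType) (V : lmodType C) (W : V -> Prop).
Hypothesis subW : subspace W.

Lemma subspace0 : W 0. Proof. by case: subW. Qed.

Lemma subspaceZ a f : W f -> W (a *: f).
Proof. by case: subW => W0 WD Wf; rewrite -[_ *: _]addr0; apply: WD. Qed.

Lemma subspaceD f g : W f -> W g -> W (f + g).
Proof. by case: subW => _ WD Wf Wg; rewrite -[f]scale1r; apply: WD. Qed.

Lemma subspaceN f : W f -> W (- f).
Proof. by rewrite -scaleN1r; apply: subspaceZ. Qed.

Lemma subspaceB f g : W f -> W g -> W (f - g).
Proof. by move=> Wf Wg; apply: subspaceD => //; apply: subspaceN. Qed.

Lemma subspace_sum (I : eqType) (r : seq I) (P : pred I) (F : I -> V) :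
  (forall i, i \in r -> P i -> W (F i)) -> W (\sum_(i <- r | P i) F i).
Proof.
move=> WF; rewrite big_seq_cond; apply: (big_ind W) => [||i /andP[]].
- exact: subspace0.
- exact: subspaceD.
- exact: WF.
Qed.

Lemma lspan_sub (X : V -> Prop) : (forall b, X b -> W b) ->
  forall f, lspan X f -> W f.
Proof.
move=> XW f [s [c [sX ->]]]; apply: subspace_sum => b bs _.
by apply: subspaceZ; apply: XW; apply: sX.
Qed.

End Subspaces.

Section Span.
Variables (C : fieldType) (V : lmodType C) (X : V -> Prop).

Lemma lspan_gen b : X b -> lspan X b.
Proof.
move=> Xb; exists [:: b], (fun=> 1); split; last by rewrite big_seq1 scale1r.
by move=> b'; rewrite inE => /eqP->.
Qed.

(** A repeated entry can be absorbed by multiplying its coefficient by its multiplicity.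
    Duplicate-free lists are the form in which two combinations can be added, coefficients being
    functions of the vector. *)
Lemma lspan_uniqP f :
  lspan X f <-> exists (s : seq V) (c : V -> C),
    [/\ uniq s, forall b, b \in s -> X b & f = \sum_(b <- s) c b *: b].
Proof.
split=> [[s [c [sX ->]]]|[s [c [_ sX ->]]]]; last by exists s, c.
exists (undup s), (fun b => (count_mem b s)%:R * c b).
split=> [||]; rewrite ?undup_uniq //; first by move=> b; rewrite mem_undup; apply: sX.
rewrite -big_undup_iterop_count; apply: eq_bigr => b _.
by rewrite -scalerA scaler_nat.
Qed.

Lemma lspan_subspace : subspace (lspan X).
Proof.
split; first by exists [::], (fun=> 0); rewrite big_nil; split.
move=> a f g /lspan_uniqP[s [c [us sX ->]]] /lspan_uniqP[t [d [ut tX ->]]].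
(* The membership indicators are needed because [c] and [d] are arbitrary outside their own
   lists. *)
pose e b := a * (b \in s)%:R * c b + (b \in t)%:R * d b.
exists (undup (s ++ t)), e.
split=> [b|]; first by rewrite mem_undup mem_cat => /orP[]; [apply: sX | apply: tX].
under [RHS]eq_bigr => b _ do rewrite scalerDl.
have restr (r : seq V) (h : V -> C) : uniq r -> {subset r <= s ++ t} ->
    \sum_(b <- undup (s ++ t)) ((b \in r)%:R * h b) *: b = \sum_(b <- r) h b *: b.
  move=> ur rst; rewrite (bigID (fun b => b \in r)) /= [X in _ + X]big1 => [|b /negbTE->].
    rewrite addr0 -big_filter; under eq_big_seq => b.
      by rewrite mem_filter => /andP[-> _]; rewrite mul1r; over.
    apply: perm_big; apply: uniq_perm => //; first by rewrite filter_uniq ?undup_uniq.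
    move=> b; rewrite mem_filter mem_undup; apply: andb_idr; exact: rst.
  by rewrite mul0r scale0r.
rewrite big_split /= restr // => [|b bt]; last by rewrite mem_cat bt orbT.
congr (_ + _); rewrite scaler_sumr.
under [RHS]eq_bigr => b _ do rewrite -mulrA -scalerA.
rewrite -!scaler_sumr restr // => b bs; first by rewrite mem_cat bs.
Qed.

End Span.

(** * Polynomials with monomials restricted to a given set, and weighted degrees *)

Section Supports.
Variables (C : fieldType) (N : nat).
Local Notation A := {mpoly C[N]}.
Implicit Types (P Q : 'X_{1..N} -> Prop) (f g : A) (m : 'X_{1..N}).

Definition supp_in P f := forall m, m \in msupp f -> P m.

Lemma supp_inP P f : supp_in P f <-> forall m, f@_m = 0 \/ P m.
Proof.
split=> Pf m; last first.
  by rewrite mcoeff_msupp => /eqP fm; case: (Pf m).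
by case: (boolP (m \in msupp f)) => [/Pf|/memN_msupp_eq0]; [right | left].
Qed.

Lemma supp_in_subspace P : subspace (supp_in P).
Proof.
split=> [m|a f g /supp_inP Pf /supp_inP Pg]; first by rewrite msupp0.
apply/supp_inP => m; rewrite mcoeffD mcoeffZ.
case: (Pf m) => [->|]; last by right.
by case: (Pg m) => [->|]; [left; rewrite mulr0 addr0 | right].
Qed.

Lemma supp_inD P f g : supp_in P f -> supp_in P g -> supp_in P (f + g).
Proof. exact: subspaceD (supp_in_subspace P) _ _. Qed.

Lemma supp_inB P f g : supp_in P f -> supp_in P g -> supp_in P (f - g).
Proof. exact: subspaceB (supp_in_subspace P) _ _. Qed.

Lemma supp_inX P m : P m -> supp_in P 'X_[m].
Proof. by move=> Pm m'; rewrite msuppX inE => /eqP->. Qed.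

Lemma supp_in_ind P (W : A -> Prop) : subspace W ->
  (forall m, P m -> W 'X_[m]) -> forall f, supp_in P f -> W f.
Proof.
move=> subW PW f Pf; rewrite [f]mpolyE; apply: subspace_sum => // m mf _.
by apply: subspaceZ => //; apply/PW/Pf.
Qed.

Lemma supp_in_mderiv P Q i f : (forall m, P (m + U_(i))%MM -> Q m) ->
  supp_in P f -> supp_in Q (mderiv i f).
Proof.
move=> PQ /supp_inP Pf; apply/supp_inP => m.
by rewrite mcoeff_deriv; case: (Pf (m + U_(i))%MM) => [->|/PQ]; [left; rewrite mul0rn | right].
Qed.

Lemma supp_in_mulX P Q i f : (forall m, P m -> Q (m + U_(i))%MM) ->
  supp_in P f -> supp_in Q ('X_i * f).
Proof.
move=> PQ Pf.
apply: (@supp_in_ind P (fun g => supp_in Q ('X_i * g))) Pf => [|m Pm].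
  have [Q0 QD] := supp_in_subspace Q.
  split=> [|a g h Qg Qh]; first by rewrite mulr0.
  rewrite mulrDr -scalerAr; apply: QD; [exact: Qg | exact: Qh].
by rewrite -mpolyXD addmC; apply: supp_inX; apply: PQ.
Qed.

Lemma mulX_mderivX i m : 'X_i * mderiv i 'X_[m] = (m i)%:R *: 'X_[m] :> A.
Proof.
rewrite mderivX -scalerAr -mpolyXD addmC.
(* When [m i = 0] the truncated difference [m - U_(i)] loses information, but the coefficient is
   then zero. *)
have [->|mi] := eqVneq (m i) 0%N; first by rewrite !scale0r.
by rewrite submK // lep1mP.
Qed.

Definition wdeg (w : 'I_N -> nat) m := (\sum_i w i * m i)%N.

Lemma wdegD w m m' : wdeg w (m + m')%MM = (wdeg w m + wdeg w m')%N.
Proof. by rewrite /wdeg -big_split; apply: eq_bigr => i _; rewrite mnmDE mulnDr. Qed.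

Lemma wdegU w i : wdeg w U_(i)%MM = w i.
Proof.
rewrite /wdeg (bigD1 i) //= mnm1E eqxx muln1 big1 ?addn0 // => j ji.
by rewrite mnm1E eq_sym (negbTE ji) muln0.
Qed.

Lemma wdeg_bound w f : exists d, supp_in (fun m => wdeg w m <= d)%N f.
Proof.
exists (\sum_(m <- msupp f) wdeg w m)%N => m mf.
by rewrite (big_rem m mf) /= leq_addr.
Qed.

End Supports.

(** * Commutation of [eta] with the other operators, and Capelli's identity *)

Section Operators.
Variables (C : numFieldType) (n : nat).
Local Notation A := {mpoly C[n + n]}.
Local Notation lo i := (lshift n i).
Local Notation hi i := (rshift n i).
Local Notation u i := ('X_(lo i) : A).
Local Notation v i := ('X_(hi i) : A).
Local Notation du i := (mderiv (lo i)).
Local Notation dv i := (mderiv (hi i)).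
Local Notation eta := (@eta_op C n).
Implicit Types (f g : A) (m : 'X_{1..n + n}).

Definition minor (i j : 'I_n) : A := u i * v j - u j * v i.
Definition dminor (i j : 'I_n) f := du i (dv j f) - du j (dv i f).
Definition transfer (i j : 'I_n) f := u j * du i f + v j * dv i f.
Definition lower f := \sum_(i < n) u i * dv i f.
Definition ueuler f := \sum_(i < n) u i * du i f.
Definition veuler f := \sum_(i < n) v i * dv i f.

Lemma mderivXU (N : nat) (i j : 'I_N) : mderiv i 'X_j = (i == j)%:R :> {mpoly C[N]}.
Proof.
rewrite mderivX mnm1E eq_sym; have [->|_] := eqVneq; last by rewrite scale0r.
rewrite scale1r (_ : U_(j) - U_(j) = 0)%MM ?mpolyX0 //.
by apply/mnmP => k; rewrite mnmBE subnn mnm0E.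
Qed.

Lemma mderiv_mulX (N : nat) (i j : 'I_N) (f : {mpoly C[N]}) :
  mderiv i ('X_j * f) = (i == j)%:R * f + 'X_j * mderiv i f.
Proof. by rewrite mderivM mderivXU. Qed.

Lemma du_mulu i j f : du i (u j * f) = (i == j)%:R * f + u j * du i f.
Proof. by rewrite mderiv_mulX (inj_eq (@lshift_inj _ _)). Qed.

Lemma du_mulv i j f : du i (v j * f) = v j * du i f.
Proof. by rewrite mderiv_mulX eq_lrshift mul0r add0r. Qed.

Lemma dv_mulu i j f : dv i (u j * f) = u j * dv i f.
Proof. by rewrite mderiv_mulX eq_rlshift mul0r add0r. Qed.

Lemma dv_mulv i j f : dv i (v j * f) = (i == j)%:R * f + v j * dv i f.
Proof. by rewrite mderiv_mulX (inj_eq (@rshift_inj _ _)). Qed.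

Lemma sum_delta (i : 'I_n) (F : 'I_n -> A) : \sum_(j < n) (i == j)%:R * F j = F i.
Proof.
rewrite (bigD1 i) //= eqxx mul1r big1 ?addr0 // => j ji.
by rewrite eq_sym (negbTE ji) mul0r.
Qed.

Lemma eta_is_linear : linear eta.
Proof.
move=> a f g; rewrite /eta_op scaler_sumr -big_split; apply: eq_bigr => i _ /=.
by rewrite linearP mulrDr scalerAr.
Qed.
HB.instance Definition _ := GRing.isLinear.Build C A A _ eta eta_is_linear.

Lemma lower_is_linear : linear lower.
Proof.
move=> a f g; rewrite /lower scaler_sumr -big_split; apply: eq_bigr => i _ /=.
by rewrite linearP mulrDr scalerAr.
Qed.
HB.instance Definition _ := GRing.isLinear.Build C A A _ lower lower_is_linear.

Lemma ueuler_is_linear : linear ueuler.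
Proof.
move=> a f g; rewrite /ueuler scaler_sumr -big_split; apply: eq_bigr => i _ /=.
by rewrite linearP mulrDr scalerAr.
Qed.
HB.instance Definition _ := GRing.isLinear.Build C A A _ ueuler ueuler_is_linear.

Lemma veuler_is_linear : linear veuler.
Proof.
move=> a f g; rewrite /veuler scaler_sumr -big_split; apply: eq_bigr => i _ /=.
by rewrite linearP mulrDr scalerAr.
Qed.
HB.instance Definition _ := GRing.isLinear.Build C A A _ veuler veuler_is_linear.

Lemma dminor_is_linear i j : linear (dminor i j).
Proof. by move=> a f g; rewrite /dminor !linearP /= scalerBr scalerN addrACA. Qed.
HB.instance Definition _ i j :=
  GRing.isLinear.Build C A A _ (dminor i j) (dminor_is_linear i j).

Lemma transfer_is_linear i j : linear (transfer i j).
Proof.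
by move=> a f g; rewrite /transfer !linearP /= !mulrDr -!scalerAr scalerDr addrACA.
Qed.
HB.instance Definition _ i j :=
  GRing.isLinear.Build C A A _ (transfer i j) (transfer_is_linear i j).

Lemma Delta_opE f : Delta_op f = - lower f.
Proof. by []. Qed.

Lemma eta_du i f : eta (du i f) = du i (eta f).
Proof.
rewrite /eta_op linear_sum; apply: eq_bigr => j _ /=.
by rewrite du_mulv mderiv_comm.
Qed.

Lemma eta_dv i f : eta (dv i f) = dv i (eta f) - du i f.
Proof.
rewrite /eta_op linear_sum /=; under [X in _ = X - _]eq_bigr => j _.
  rewrite dv_mulv mderiv_comm; over.
by rewrite big_split /= sum_delta [du i f + _]addrC addrK.
Qed.

Lemma eta_mulu i f : eta (u i * f) = u i * eta f + v i * f.
Proof.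
rewrite /eta_op; under eq_bigr => j _.
  rewrite du_mulu mulrDr mulrCA [X in _ + X]mulrCA eq_sym; over.
rewrite big_split /= -mulr_sumr addrC; congr (_ + _).
by rewrite sum_delta.
Qed.

Lemma eta_mulv i f : eta (v i * f) = v i * eta f.
Proof.
rewrite /eta_op mulr_sumr; apply: eq_bigr => j _.
by rewrite du_mulv mulrCA.
Qed.

(** The sl2 relation: the commutator of [eta] and [lower], which is minus [Delta_op], is the Cartan
    element [veuler - ueuler]. *)
Lemma eta_lower f : eta (lower f) = lower (eta f) + veuler f - ueuler f.
Proof.
rewrite /lower linear_sum /=; under eq_bigr => j _ do rewrite eta_mulu eta_dv mulrBr.
by rewrite big_split /= sumrB addrAC.
Qed.

(** [eta] is the derivation sending [u i] to [v i] and [v i] to 0, so it sends the minor to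
    [v i * v j - v j * v i = 0]. *)
Lemma eta_minor i j f : eta (minor i j * f) = minor i j * eta f.
Proof.
rewrite /minor mulrBl [RHS]mulrBl [LHS]linearB /= -2![_ * _ * f]mulrA -2![_ * _ * eta f]mulrA.
rewrite (eta_mulu i) (eta_mulu j) (eta_mulv i) (eta_mulv j).
by rewrite [v j * (v i * f)]mulrCA opprD addrACA subrr addr0.
Qed.

Lemma eta_dminor i j f : eta (dminor i j f) = dminor i j (eta f).
Proof.
rewrite /dminor (raddfB eta) /= (eta_du i) (eta_du j) (eta_dv i) (eta_dv j).
rewrite (mderivB (lo i)) (mderivB (lo j)) (mderiv_comm (lo i) (lo j)).
by rewrite opprB addrA addrNK.
Qed.

Lemma eta_transfer i j f : eta (transfer i j f) = transfer i j (eta f).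
Proof.
rewrite /transfer (raddfD eta) /= (eta_mulu j) (eta_mulv j) (eta_du i) (eta_dv i).
by rewrite mulrBr addrACA subrr addr0.
Qed.

(** Both minors are antisymmetric in [i], [j], so the sum over [i < j] equals the sum over all pairs
    of [K i j], which is 0 on the diagonal. Expanding [dminor], one half is [ueuler (veuler f)]; the
    other is [lower (eta f)] up to the term [ueuler f] produced by commuting [eta] past the
    [dv i]. *)
Lemma capelli f :
  \sum_(i < n) \sum_(j < n | (i < j)%N) minor i j * dminor i j f =
  ueuler (veuler f) + ueuler f - lower (eta f).
Proof.
pose G i j := minor i j * dminor i j f.
pose K (i j : 'I_n) := u i * v j * dminor i j f.
have Gsym i j : G i j = G j i.
  rewrite /G /minor /dminor -[u i * _ - _]opprB -[du i _ - _]opprB.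
  by rewrite mulrN mulNr opprK.
have GK i j : G i j = K i j + K j i.
  rewrite /G /K /minor /dminor [u j * v i]mulrC mulrBl.
  by rewrite -[du j _ - _]opprB mulrN [v i * u j]mulrC.
transitivity (\sum_(i < n) \sum_(j < n) K i j).
  rewrite pair_big_dep (pair_bigA _ K) /=.
  rewrite [RHS](bigID (fun p : 'I_n * 'I_n => (p.1 < p.2)%N)) /=.
  rewrite [X in _ = _ + X](bigID (fun p : 'I_n * 'I_n => (p.2 < p.1)%N)) /=.
  rewrite [X in _ = _ + (_ + X)]big1 => [|[i j] /=]; last first.
    rewrite -!leqNgt -eqn_leq => /eqP/val_inj->.
    by rewrite /K /dminor subrr mulr0.
  rewrite addr0 [X in _ = _ + X](reindex (fun p : 'I_n * 'I_n => (p.2, p.1))) /=; last first.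
    by exists (fun p : 'I_n * 'I_n => (p.2, p.1)) => -[].
  rewrite [X in _ = _ + X](eq_bigl (fun p : 'I_n * 'I_n => (p.1 < p.2)%N)) => [|[i j] /=].
    by rewrite -big_split; apply: eq_bigr => -[i j] _ /=; rewrite -GK.
  by case: ltngtP.
have uv : ueuler (veuler f) = \sum_(i < n) \sum_(j < n) u i * v j * du i (dv j f).
  apply: eq_bigr => i _; rewrite /veuler linear_sum mulr_sumr; apply: eq_bigr => j _ /=.
  by rewrite du_mulv mulrA.
have le : lower (eta f) =
    ueuler f + \sum_(i < n) \sum_(j < n) u i * v j * du j (dv i f).
  rewrite /ueuler -big_split; apply: eq_bigr => i _ /=.
  rewrite -[dv i _](subrK (du i f)) -eta_dv mulrDr addrC; congr (_ + _).
  rewrite /eta_op mulr_sumr; apply: eq_bigr => j _ /=.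
  by rewrite mulrA.
rewrite uv le opprD addrA addrK -sumrB; apply: eq_bigr => i _.
by rewrite -sumrB; apply: eq_bigr => j _; rewrite /K /dminor mulrBr.
Qed.

End Operators.

(** * The grading, the sl2 commutation formula, and the direct sum for nonnegative degree *)

Section Grading.
Variables (C : numFieldType) (n : nat).
Local Notation A := {mpoly C[n + n]}.
Local Notation lo i := (lshift n i).
Local Notation hi i := (rshift n i).
Local Notation u i := ('X_(lo i) : A).
Local Notation v i := ('X_(hi i) : A).
Local Notation du i := (mderiv (lo i)).
Local Notation dv i := (mderiv (hi i)).
Local Notation eta := (@eta_op C n).
Local Notation lower := (@lower C n).
Implicit Types (f g : A) (m : 'X_{1..n + n}).

Definition udeg m := (\sum_(i < n) m (lo i))%N.
Definition vdeg m := (\sum_(i < n) m (hi i))%N.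

Lemma udegD m m' : udeg (m + m')%MM = (udeg m + udeg m')%N.
Proof. by rewrite /udeg -big_split; apply: eq_bigr => i _; rewrite mnmDE. Qed.

Lemma vdegD m m' : vdeg (m + m')%MM = (vdeg m + vdeg m')%N.
Proof. by rewrite /vdeg -big_split; apply: eq_bigr => i _; rewrite mnmDE. Qed.

Lemma udegU_lo i : udeg U_(lo i)%MM = 1%N.
Proof.
rewrite /udeg (bigD1 i) //= mnm1E eqxx big1 // => j ji.
by rewrite mnm1E (inj_eq (@lshift_inj _ _)) eq_sym (negbTE ji).
Qed.

Lemma udegU_hi i : udeg U_(hi i)%MM = 0%N.
Proof. by rewrite /udeg big1 // => j _; rewrite mnm1E eq_rlshift. Qed.

Lemma vdegU_hi i : vdeg U_(hi i)%MM = 1%N.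
Proof.
rewrite /vdeg (bigD1 i) //= mnm1E eqxx big1 // => j ji.
by rewrite mnm1E (inj_eq (@rshift_inj _ _)) eq_sym (negbTE ji).
Qed.

Lemma vdegU_lo i : vdeg U_(lo i)%MM = 0%N.
Proof. by rewrite /vdeg big1 // => j _; rewrite mnm1E eq_lrshift. Qed.

Definition degE := (udegD, vdegD, udegU_lo, udegU_hi, vdegU_lo, vdegU_hi).

Lemma lo_Tlow i : lo i \in Tlow n.
Proof. exact: imset_f. Qed.

Lemma hi_Tlow i : (hi i \in Tlow n) = false.
Proof.
by apply/negP => /imsetP[j _ /eqP]; rewrite eq_rlshift.
Qed.

(** Membership in a graded piece becomes a condition on single monomials, written without
    subtraction of degrees so that each operator's effect on it is linear arithmetic. *)
Lemma AgrP k f :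
  Agr k f <-> supp_in (fun m => (vdeg m)%:Z = (udeg m)%:Z + k) f.
Proof.
have degP m : (\sum_(i | i \notin Tlow n) (m i)%:Z - \sum_(i | i \in Tlow n) (m i)%:Z = k)
     <-> ((vdeg m)%:Z = (udeg m)%:Z + k).
  have -> : \sum_(i | i \in Tlow n) (m i)%:Z = (udeg m)%:Z.
    rewrite big_split_ord /= [X in _ + X]big_pred0 => [|i]; last exact: hi_Tlow.
    rewrite addr0 /udeg (big_morph Posz PoszD (erefl 0)); apply: eq_bigl => i; exact: lo_Tlow.
  have -> : \sum_(i | i \notin Tlow n) (m i)%:Z = (vdeg m)%:Z.
    rewrite big_split_ord /= [X in X + _]big_pred0 => [|i]; last by rewrite lo_Tlow.
    rewrite add0r /vdeg (big_morph Posz PoszD (erefl 0)); apply: eq_bigl => i; by rewrite hi_Tlow.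
  by split; lia.
split; last first.
  apply: supp_in_ind; first exact: lspan_subspace.
  by move=> m mk; apply: lspan_gen; exists m; split=> //; apply/degP.
apply: lspan_sub; first exact: supp_in_subspace.
by move=> b [m [mk ->]]; apply: supp_inX; apply/degP.
Qed.

Lemma Agr_subspace k : subspace (@Agr C n k).
Proof. exact: lspan_subspace. Qed.

Lemma ueulerX m : ueuler 'X_[m] = (udeg m)%:R *: 'X_[m] :> A.
Proof.
rewrite /udeg natr_sum scaler_suml; apply: eq_bigr => i _.
exact: mulX_mderivX.
Qed.

Lemma veulerX m : veuler 'X_[m] = (vdeg m)%:R *: 'X_[m] :> A.
Proof.
rewrite /vdeg natr_sum scaler_suml; apply: eq_bigr => i _.
exact: mulX_mderivX.
Qed.

Lemma mcoeff_diag (L : {linear A -> A}) (c : 'X_{1..n + n} -> C) m f :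
  (forall m', L 'X_[m'] = c m' *: 'X_[m']) -> (L f)@_m = c m * f@_m.
Proof.
move=> LX.
have -> : f@_m = \sum_(m' <- msupp f) (f@_m' *: 'X_[m'])@_m.
  by rewrite {1}[f]mpolyE raddf_sum.
rewrite {1}[f]mpolyE linear_sum raddf_sum mulr_sumr /=; apply: eq_bigr => m' _.
rewrite linearZ /= LX !mcoeffZ mcoeffX.
by have [->|] := eqVneq m' m; rewrite ?mulr0 // !mulr1 mulrC.
Qed.

Lemma mcoeff_ueuler m f : (ueuler f)@_m = (udeg m)%:R * f@_m.
Proof. exact: mcoeff_diag ueulerX. Qed.

Lemma mcoeff_veuler m f : (veuler f)@_m = (vdeg m)%:R * f@_m.
Proof. exact: mcoeff_diag veulerX. Qed.

Lemma veuler_Agr k f : Agr k f -> veuler f = ueuler f + k%:~R *: f.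
Proof.
move=> /AgrP/supp_inP fk; apply/mpolyP => m.
rewrite mcoeffD mcoeffZ mcoeff_ueuler mcoeff_veuler.
have [->|mk] := fk m; first by rewrite !mulr0 addr0.
by rewrite -mulrDl pmulrn mk intrD -pmulrn.
Qed.

Lemma Agr_mulu k i f : Agr k f -> Agr (k - 1) (u i * f).
Proof. by move=> /AgrP fk; apply/AgrP; apply: supp_in_mulX fk => m; rewrite !degE; lia. Qed.

Lemma Agr_mulv k i f : Agr k f -> Agr (k + 1) (v i * f).
Proof. by move=> /AgrP fk; apply/AgrP; apply: supp_in_mulX fk => m; rewrite !degE; lia. Qed.

Lemma Agr_du k i f : Agr k f -> Agr (k + 1) (du i f).
Proof. by move=> /AgrP fk; apply/AgrP; apply: supp_in_mderiv fk => m; rewrite !degE; lia. Qed.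

Lemma Agr_dv k i f : Agr k f -> Agr (k - 1) (dv i f).
Proof. by move=> /AgrP fk; apply/AgrP; apply: supp_in_mderiv fk => m; rewrite !degE; lia. Qed.

Lemma Agr_eta k f : Agr k f -> Agr (k + 2) (eta f).
Proof.
move=> fk; apply: subspace_sum; first exact: Agr_subspace.
by move=> i _ _; rewrite (_ : k + 2 = k + 1 + 1); [apply/Agr_mulv/Agr_du | rewrite -addrA].
Qed.

Lemma Agr_lower k f : Agr k f -> Agr (k - 2) (lower f).
Proof.
move=> fk; apply: subspace_sum; first exact: Agr_subspace.
by move=> i _ _; rewrite (_ : k - 2 = k - 1 - 1); [apply/Agr_mulu/Agr_dv | rewrite -addrA].
Qed.

Lemma Agr_minor k i j f : Agr k f -> Agr k (minor C i j * f).
Proof.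
move=> fk; rewrite /minor mulrBl -!mulrA -[k](addrK 1).
by apply: subspaceB; [exact: Agr_subspace | |]; apply/Agr_mulu/Agr_mulv.
Qed.

Lemma Agr_dminor k i j f : Agr k f -> Agr k (dminor i j f).
Proof.
move=> fk; rewrite /dminor -[k](subrK 1).
by apply: subspaceB; [exact: Agr_subspace | |]; apply/Agr_du/Agr_dv.
Qed.

Lemma Agr_transfer k i j f : Agr k f -> Agr k (transfer i j f).
Proof.
move=> fk; apply: subspaceD; first exact: Agr_subspace.
  by rewrite -[k](addrK 1); apply/Agr_mulu/Agr_du.
by rewrite -[k](subrK 1); apply/Agr_mulv/Agr_dv.
Qed.

Lemma Agr_iter_eta k N f : Agr k f -> Agr (k + N%:Z *+ 2) (iter N eta f).
Proof.
move=> fk; elim: N => [|N IH]; first by rewrite addr0.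
rewrite (_ : k + N.+1%:Z *+ 2 = k + N%:Z *+ 2 + 2); last by lia.
exact: Agr_eta.
Qed.

Lemma eta_lower_Agr k f : Agr k f -> eta (lower f) = lower (eta f) + k%:~R *: f.
Proof. by move=> fk; rewrite eta_lower (veuler_Agr fk) addrA addrAC addrK. Qed.

Lemma iter_linear (V : lmodType C) (L : {linear V -> V}) N : linear (iter N L).
Proof. by elim: N => // N IH a f g /=; rewrite IH linearP. Qed.

(** Moving [lower] through [N.+1] copies of [eta] produces one commutator for each, acting by the
    weights [k], [k + 2], ..., [k + 2N], whose sum is [(N + 1)(k + N)]. *)
Lemma iter_eta_lower k N f : Agr k f ->
  iter N.+1 eta (lower f) =
  lower (iter N.+1 eta f) + (N.+1%:R * (k%:~R + N%:R)) *: iter N eta f.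
Proof.
move=> fk; elim: N => [|N IH] /=; first by rewrite mul1r addr0 (eta_lower_Agr fk).
rewrite -iterS IH linearD linearZ /= (eta_lower_Agr (Agr_iter_eta N.+1 fk)).
rewrite -addrA /= -scalerDl; congr (_ + _ *: _).
by rewrite intrD rmorphMn /= -pmulrn -!natr1; ring.
Qed.

(** Each [eta] lowers the u-degree by one; the strict bound [udeg m < d] makes the case [d = 0] say
    that [f] vanishes. *)
Lemma eta_nilpotent f : exists N, iter N eta f = 0.
Proof.
have [d fd] : exists d, supp_in (fun m => udeg m < d)%N f.
  exists (\sum_(m <- msupp f) udeg m).+1 => m mf.
  by rewrite ltnS (big_rem m mf) /= leq_addr.
exists d; elim: d f fd => [|d IH] f fd.
  by apply/mpolyP => m; have [->|//] := (supp_inP _ f).1 fd m; rewrite mcoeff0.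
rewrite iterSr; apply: IH; apply: subspace_sum => [|i _ _]; first exact: supp_in_subspace.
apply: (@supp_in_mulX _ _ (fun m => udeg m < d)%N) => [m|]; first by rewrite !degE addn0.
by apply: supp_in_mderiv fd => m; rewrite !degE addn1.
Qed.

Lemma sl2_coef_neq0 (k : int) N : 0 < k -> N.+1%:R * (k%:~R + N%:R) != 0 :> C.
Proof.
move=> k0; rewrite mulf_eq0 pnatr_eq0 /= pmulrn -intrD intr_eq0; lia.
Qed.

(** Induction on an exponent [N] for which that power of [eta] kills [h]. By [iter_eta_lower],
    subtracting [c^-1 *: eta (lower h)] from [h], with [c] the nonzero sl2 coefficient, yields an
    element killed by one power less. *)
Lemma eta_lower_surj k h : 0 < k -> Agr k h ->
  exists2 g, Agr k g & eta (lower g) = h.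
Proof.
move=> k0; have [N] := eta_nilpotent h; elim: N h => [|N IH] h.
  by move=> /= -> hk; exists 0; [exact: subspace0 (Agr_subspace k) | rewrite !linear0].
move=> hN hk; have c0 := sl2_coef_neq0 N k0.
set c := (_ * _ : C) in c0.
have Fk : Agr k (eta (lower h)) by rewrite -[k](subrK 2); apply/Agr_eta/Agr_lower.
have [||g gk gE] := IH (h - c^-1 *: eta (lower h)).
- have itl := @iter_linear _ [the {linear A -> A} of eta] N.
  rewrite -scaleN1r addrC [_ *: (_ *: _)]scalerA.
  rewrite [LHS]itl -iterSr (iter_eta_lower N hk) hN linear0 add0r.
  by rewrite scalerA -mulrA mulVf // mulr1 scaleN1r addNr.
- by apply: subspaceB => //; [exact: Agr_subspace | apply: subspaceZ => //; exact: Agr_subspace].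
exists (g + c^-1 *: h); last by rewrite linearD linearZ /= linearD linearZ /= gE subrK.
by apply: subspaceD => //; [exact: Agr_subspace | apply: subspaceZ => //; exact: Agr_subspace].
Qed.

(** If [eta] to the power [N.+1] kills [g], the commutation formula leaves only a nonzero multiple
    of [iter N eta g], which must therefore vanish; descend to [N = 0]. *)
Lemma eta_lower_inj k g : 0 < k -> Agr k g -> eta (lower g) = 0 -> g = 0.
Proof.
move=> k0 gk g0; have [N] := eta_nilpotent g; elim: N => [|N IH] // gN.
apply: IH; have := iter_eta_lower N gk.
rewrite gN linear0 add0r iterSr g0 => /esym/eqP.
have -> : iter N eta 0 = 0 by elim: N {gN} => //= N ->; rewrite linear0.
by rewrite scaler_eq0 (negbTE (sl2_coef_neq0 _ k0)) => /eqP.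
Qed.

(** As [k + 2 > 0], the map [eta] after [lower] is bijective in degree [k + 2]. Solving
    [eta (lower g) = eta f] there splits [f] into [f - lower g], killed by [eta], and [lower g];
    injectivity makes the sum direct. *)
Lemma Agr_direct_sum k : 0 <= k ->
  direct_sum (@Agr C n k) (@Hgr' C n k) (image_of (@Delta_op C n) (@Agr C n (k + 2))).
Proof.
move=> k0; have k2 : 0 < k + 2 by lia.
have sk := Agr_subspace k; have sk2 := Agr_subspace (k + 2).
split=> [f|f [fk f0] [g [gk fE]]]; last first.
  have g0 : g = 0.
    apply: (eta_lower_inj k2 gk); move: f0; rewrite fE Delta_opE linearN /=.
    by move/eqP; rewrite oppr_eq0 => /eqP.
  by rewrite fE g0 Delta_opE linear0 oppr0.
split=> [fk|[x [w [[xk _] [g [gk ->]] ->]]]]; last first.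
  apply: subspaceD => //; rewrite Delta_opE; apply: subspaceN => //.
  by rewrite -[k](addrK 2); apply: Agr_lower.
have [g gk gE] := eta_lower_surj k2 (Agr_eta fk).
have lk : Agr k (lower g) by rewrite -[k](addrK 2); apply: Agr_lower.
exists (f - lower g), (lower g); split; last by rewrite subrK.
  by split; [apply: subspaceB | rewrite linearB /= gE subrr].
exists (- g); split; first exact: subspaceN.
by rewrite Delta_opE linearN opprK.
Qed.

End Grading.

(** * Linear conditions on a sum of lines, checked on the generators *)

Section SpannedSubspaces.
Variables (K : fieldType) (vT : vectType K) (Q : vT -> Prop).
Hypothesis subQ : subspace Q.

Lemma addv_subspace (U V : {vspace vT}) :
  (forall x, x \in U -> Q x) -> (forall x, x \in V -> Q x) ->
  forall x, x \in (U + V)%VS -> Q x.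
Proof.
move=> UQ VQ x /memv_addP[a aU [b bV ->]].
by apply: subspaceD => //; [apply: UQ | apply: VQ].
Qed.

Lemma sumv_subspace (I : finType) (P : pred I) (Us : I -> {vspace vT}) :
  (forall i, P i -> forall x, x \in Us i -> Q x) ->
  forall x, x \in (\sum_(i | P i) Us i)%VS -> Q x.
Proof.
move=> UQ x /memv_sumP[a aU ->].
by apply: subspace_sum => // i _ Pi; apply: (UQ i) => //; apply: aU.
Qed.

Lemma vline_subspace y : Q y -> forall x, x \in <[y]>%VS -> Q x.
Proof. by move=> Qy x /vlineP[a ->]; apply: subspaceZ. Qed.

End SpannedSubspaces.

(** * The action of so(2n) through transfers, minors and dual minors, and the structure of the
    kernel of [eta] *)

Section Action.
Variables (C : numFieldType) (n : nat).
Local Notation A := {mpoly C[n + n]}.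
Local Notation lo i := (lshift n i).
Local Notation hi i := (rshift n i).
Local Notation u i := ('X_(lo i) : A).
Local Notation v i := ('X_(hi i) : A).
Local Notation du i := (mderiv (lo i)).
Local Notation dv i := (mderiv (hi i)).
Local Notation eta := (@eta_op C n).
Local Notation T := (Tlow n).
Implicit Types (f g : A) (m : 'X_{1..n + n}) (W : A -> Prop).

Lemma glactDl M P f : glact T (M + P) f = glact T M f + glact T P f.
Proof.
rewrite /glact -big_split; apply: eq_bigr => i _; rewrite -big_split.
by apply: eq_bigr => j _; rewrite mxE scalerDl.
Qed.

Lemma glactZl a M f : glact T (a *: M) f = a *: glact T M f.
Proof.
rewrite /glact scaler_sumr; apply: eq_bigr => i _; rewrite scaler_sumr.
by apply: eq_bigr => j _; rewrite mxE scalerA.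
Qed.

Lemma glact0l f : glact T 0 f = 0.
Proof. by rewrite -(scale0r (0 : 'M_(n + n))) glactZl scale0r. Qed.

Lemma glactBl M P f : glact T (M - P) f = glact T M f - glact T P f.
Proof. by rewrite glactDl -scaleN1r glactZl scaleN1r. Qed.

Lemma glactE a b f : glact T (Emx C a b) f = Eact T a b f.
Proof.
rewrite /glact (bigD1 a) //= (bigD1 b) //= mxE !eqxx scale1r.
rewrite big1 => [|j /negbTE jb]; last by rewrite mxE jb andbF scale0r.
rewrite addr0 big1 ?addr0 // => i /negbTE ia.
by rewrite big1 // => j _; rewrite mxE ia scale0r.
Qed.

Lemma glact_vecA i j f :
  glact T (vecA C i j) f = - transfer i j f - (i == j)%:R *: f.
Proof.
rewrite /vecA glactBl !glactE /Eact !lo_Tlow !hi_Tlow (inj_eq (@lshift_inj _ _)).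
by rewrite /transfer opprD addrAC.
Qed.

Lemma glact_vecB i j f : glact T (vecB C i j) f = dminor i j f.
Proof. by rewrite /vecB glactBl !glactE /Eact !lo_Tlow !hi_Tlow. Qed.

Lemma glact_vecC i j f : glact T (vecC C i j) f = - (minor C i j * f).
Proof.
rewrite /vecC glactBl !glactE /Eact !lo_Tlow !hi_Tlow /minor mulrBl opprB opprK.
by rewrite [v j * u i]mulrC [v i * u j]mulrC addrC.
Qed.

Lemma glact_subspace (Q : A -> Prop) f : subspace Q -> subspace (fun M => Q (glact T M f)).
Proof.
move=> [Q0 QD]; split; first by rewrite glact0l.
by move=> a M P QM QP; rewrite glactDl glactZl; apply: QD.
Qed.

(** Stability under so(2n) is tested on its spanning vectors, and a subspace does not see their
    signs or the scalar shift in [glact_vecA]. *)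
Lemma so_submoduleP W :
  so_submodule T W <->
  [/\ subspace W, forall i j f, W f -> W (transfer i j f),
      forall (i j : 'I_n) f, (i < j)%N -> W f -> W (minor C i j * f) &
      forall (i j : 'I_n) f, (i < j)%N -> W f -> W (dminor i j f)].
Proof.
split=> [[subW Wso]|[subW Wt Wm Wd]]; last first.
  split=> // g f gso Wf; move: g gso.
  have sQ := glact_subspace f subW.
  apply: (addv_subspace sQ); apply: (sumv_subspace sQ) => i _.
    apply: (sumv_subspace sQ) => j _; apply: (vline_subspace sQ).
    rewrite glact_vecA; apply: subspaceB => //; last exact: subspaceZ.
    by apply: subspaceN => //; apply: Wt.
  apply: (sumv_subspace sQ) => j ij; apply: (addv_subspace sQ); apply: (vline_subspace sQ).
    by rewrite glact_vecB; apply: Wd.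
  by rewrite glact_vecC; apply: subspaceN => //; apply: Wm.
have soA i j : vecA C i j \in so C n.
  rewrite memvE; apply: subv_trans (addvSl _ _).
  by rewrite (sumv_sup i) // (sumv_sup j).
have soBC (i j : 'I_n) : (i < j)%N -> (<[vecB C i j]> + <[vecC C i j]> <= so C n)%VS.
  move=> ij; apply: subv_trans (addvSr _ _).
  by rewrite (sumv_sup i) // (sumv_sup j).
split=> // i j f.
- move=> Wf; have /(subspaceN subW) := Wso _ _ (soA i j) Wf.
  rewrite glact_vecA opprD opprK => /(subspaceD subW) WD.
  have := WD _ (subspaceZ subW (- (i == j)%:R) Wf).
  by rewrite opprK scaleNr addrK.
- move=> ij Wf; rewrite -[_ * f]opprK -glact_vecC; apply: subspaceN => //.
  by apply: Wso => //; rewrite memvE; apply: subv_trans (addvSr _ _) (soBC i j ij).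
- move=> ij Wf; rewrite -glact_vecB.
  by apply: Wso => //; rewrite memvE; apply: subv_trans (addvSl _ _) (soBC i j ij).
Qed.

Lemma Hgr'_subspace k : subspace (@Hgr' C n k).
Proof.
have sk := Agr_subspace C n k.
split=> [|a f g [fk f0] [gk g0]]; first by split; [exact: subspace0 | rewrite linear0].
split; first by case: sk => _; apply.
by rewrite linearP /= f0 g0 scaler0 addr0.
Qed.

Lemma Hgr'_minor k i j f : Hgr' k f -> Hgr' k (minor C i j * f).
Proof. by case=> fk f0; split; [exact: Agr_minor | rewrite eta_minor f0 mulr0]. Qed.

Lemma Hgr'_dminor k i j f : Hgr' k f -> Hgr' k (dminor i j f).
Proof. by case=> fk f0; split; [exact: Agr_dminor | rewrite eta_dminor f0 linear0]. Qed.

Lemma Hgr'_transfer k i j f : Hgr' k f -> Hgr' k (transfer i j f).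
Proof. by case=> fk f0; split; [exact: Agr_transfer | rewrite eta_transfer f0 linear0]. Qed.

Lemma Hgr'_submodule k : so_submodule T (@Hgr' C n k).
Proof.
apply/so_submoduleP; split=> [|i j f|i j f _|i j f _].
- exact: Hgr'_subspace.
- exact: Hgr'_transfer.
- exact: Hgr'_minor.
- exact: Hgr'_dminor.
Qed.

Lemma capelli_coef k f m : Hgr' k f ->
  (\sum_(i < n) \sum_(j < n | (i < j)%N) minor C i j * dminor i j f)@_m =
  ((udeg m)%:R * (vdeg m).+1%:R) * f@_m.
Proof.
case=> _ f0; rewrite capelli f0 linear0 subr0 mcoeffD !mcoeff_ueuler mcoeff_veuler.
by rewrite -natr1 mulrDr mulr1 mulrDl mulrA.
Qed.

(* Capelli's identity makes the operator [sum minor * dminor] act on the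
   component of u-degree [d] of [Hgr' k] by the nonzero scalar
   [d (d + k + 1)], which lowers the u-degree of a generic element. *)
Lemma Hgr'_ind k W : 0 <= k -> subspace W ->
  (forall m, udeg m = 0%N -> (vdeg m)%:Z = k -> W 'X_[m]) ->
  (forall (i j : 'I_n) f, (i < j)%N -> W f -> W (minor C i j * f)) ->
  forall f, Hgr' k f -> W f.
Proof.
move=> k0 subW Wv Wminor f fH.
have [d fd] : exists d, supp_in (fun m => udeg m <= d)%N f.
  exists (\sum_(m <- msupp f) udeg m)%N => m mf.
  by rewrite (big_rem m mf) /= leq_addr.
elim: d f fd fH => [|d IH] f fd fH.
  have [/AgrP fk _] := fH.
  apply: (@supp_in_ind _ _ (fun m => udeg m = 0%N /\ (vdeg m)%:Z = k)) => // [m []|m mf].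
    exact: Wv.
  by have := fd m mf; have := fk m mf; rewrite leqn0 => mk /eqP m0; rewrite mk m0 add0r.
pose g := \sum_(i < n) \sum_(j < n | (i < j)%N) minor C i j * dminor i j f.
have gW (V : A -> Prop) : subspace V ->
    (forall i j : 'I_n, (i < j)%N -> V (minor C i j * dminor i j f)) -> V g.
  move=> sV Vij; apply: subspace_sum => // i _ _; apply: subspace_sum => // j _; exact: Vij.
have Wg : W g.
  apply: gW => // i j ij; apply: Wminor => //; apply: IH; last exact: Hgr'_dminor.
  apply: supp_inB.
    apply: (@supp_in_mderiv _ _ (fun m => udeg m <= d.+1)%N) => [m|].
      by rewrite !degE addn1.
    by apply: supp_in_mderiv fd => m; rewrite !degE addn0.
  apply: (@supp_in_mderiv _ _ (fun m => udeg m <= d.+1)%N) => [m|].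
    by rewrite !degE addn1.
  by apply: supp_in_mderiv fd => m; rewrite !degE addn0.
have Hg : Hgr' k g.
  apply: gW => [|i j ij]; first exact: Hgr'_subspace.
  by apply: Hgr'_minor; apply: Hgr'_dminor.
(* The Capelli scalar at u-degree [d.+1], where the v-degree is [d.+1 + k]. In [c *: f - g] the
   component of that u-degree cancels, so the induction hypothesis applies to the difference. *)
pose c : C := d.+1%:R * (d.+1 + `|k| + 1)%N%:R.
have c0 : c != 0 by rewrite mulf_eq0 !pnatr_eq0 addn1.
have Hh : Hgr' k (c *: f - g).
  have sH := Hgr'_subspace k.
  by apply: (subspaceB sH) => //; apply: (subspaceZ sH).
have Wh : W (c *: f - g).
  apply: IH => //; apply/supp_inP => m; rewrite mcoeffB mcoeffZ (capelli_coef m fH).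
  case: ((supp_inP _ f).1 fd m) => [->|]; first by left; rewrite !mulr0 subr0.
  have [/AgrP/supp_inP fk _] := fH.
  case: (fk m) => [->|mk]; first by left; rewrite !mulr0 subr0.
  rewrite leq_eqVlt => /orP[/eqP md|]; last by rewrite ltnS; right.
  have -> : (vdeg m).+1 = (d.+1 + `|k| + 1)%N by lia.
  by left; rewrite md subrr.
rewrite -[f]scale1r -(mulVf c0) -scalerA; apply: subspaceZ => //.
by rewrite -[_ *: f](subrK g); apply: subspaceD.
Qed.

End Action.

(** * Irreducibility of the kernel of [eta] in nonnegative degree *)

Section Irreducibility.
Variables (C : numFieldType) (n : nat).
Hypothesis hn : (1 < n)%N.
Local Notation A := {mpoly C[n + n]}.
Local Notation lo i := (lshift n i).
Local Notation hi i := (rshift n i).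
Local Notation u i := ('X_(lo i) : A).
Local Notation v i := ('X_(hi i) : A).
Local Notation du i := (mderiv (lo i)).
Local Notation dv i := (mderiv (hi i)).
Local Notation T := (Tlow n).
Local Notation last := (idx_last hn).
Implicit Types (f g : A) (m : 'X_{1..n + n}) (W : A -> Prop).

Lemma mderiv_supp0 (N : nat) (P : 'X_{1..N} -> Prop) (i : 'I_N) (f : {mpoly C[N]}) :
  (forall m : 'X_{1..N}, ~ P (m + U_(i))%MM) -> supp_in P f -> mderiv i f = 0.
Proof.
move=> nP Pf; have := supp_in_mderiv (Q := fun=> False) nP Pf.
by move=> /supp_inP f0; apply/mpolyP => m; rewrite mcoeff0; case: (f0 m).
Qed.

Lemma mderiv_eq0_supp (N : nat) (i : 'I_N) (f : {mpoly C[N]}) :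
  mderiv i f = 0 -> supp_in (fun m : 'X_{1..N} => m i = 0%N) f.
Proof.
move=> f0; apply/supp_inP => m; case mi: (m i) => [|a]; [by right | left].
have: (mderiv i f)@_(m - U_(i)) = 0 by rewrite f0 mcoeff0.
rewrite mcoeff_deriv submK ?lep1mP ?mi // => /eqP.
by rewrite -mulr_natr mulf_eq0 pnatr_eq0 orbF => /eqP.
Qed.

Lemma udeg_eq0 m i : udeg m = 0%N -> m (lo i) = 0%N.
Proof. by move=> /eqP; rewrite /udeg sum_nat_eq0 => /forall_inP/(_ i isT)/eqP. Qed.

Lemma monomial_v_last k m : udeg m = 0%N -> (vdeg m)%:Z = k ->
  (forall i, i != last -> m (hi i) = 0%N) -> 'X_[m] = v last ^+ `|k|%N.
Proof.
move=> m0 mk mi; rewrite mpolyXn; congr 'X_[_]; apply/mnmP => a.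
rewrite mulmnE mnm1E -[a]splitK; case: (split a) => i /=.
  by rewrite eq_rlshift udeg_eq0.
rewrite (inj_eq (@rshift_inj _ _)) eq_sym.
have [->|il] := eqVneq; last by rewrite mi.
move: mk; rewrite /vdeg (bigD1 last) //= big1 ?addn0 => [<-|j]; last exact: mi.
by rewrite mul1n.
Qed.

(** [transfer last j] moves one unit of exponent from [v last] to [v j], so every monomial in the
    [v i] is reached from the power of [v last]. The induction is on the number of factors other
    than [v last]. *)
Lemma v_monomial_transfer k W : subspace W ->
  (forall i j f, W f -> W (transfer i j f)) -> W (v last ^+ `|k|%N) ->
  forall m, udeg m = 0%N -> (vdeg m)%:Z = k -> W 'X_[m].
Proof.
move=> subW Wt Wv m; move Ed: (vdeg m - m (hi last))%N => d.
elim: d m Ed => [|d IH] m Ed m0 mk.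
  rewrite (monomial_v_last m0 mk) // => i il; move: Ed.
  by rewrite /vdeg (bigD1 last) //= addKn (bigD1 i) //=; lia.
have [j jl mj] : exists2 j, j != last & m (hi j) != 0%N.
  apply/exists_inP; apply: contraT => /exists_inPn h.
  move: Ed; rewrite /vdeg (bigD1 last) //= addKn big1 // => i /h.
  by rewrite negbK => /eqP.
pose m0' := (m - U_(hi j))%MM; have mE : m = (m0' + U_(hi j))%MM.
  by rewrite submK // lep1mP.
pose m1 := (m0' + U_(hi last))%MM.
have m1l : m1 (hi last) = (m (hi last)).+1.
  rewrite !mnmDE mnmBE !mnm1E eqxx (inj_eq (@rshift_inj _ _)) (negbTE jl); lia.
have Wm1 : W 'X_[m1].
  apply: IH.
  - by rewrite m1l; move: Ed; rewrite mE /m1 !degE subnS => ->.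
  - by rewrite -m0 mE /m1 !degE.
  - by rewrite -mk mE /m1 !degE.
(* Since [m1] has u-degree 0, this transfer sends its monomial to [m1 (hi last)] times that of [m],
   and the factor is invertible in characteristic zero. *)
have /(subspaceZ subW ((m1 (hi last))%:R^-1)) := Wt last j _ Wm1.
rewrite /transfer (@mderiv_supp0 _ (fun m => udeg m = 0%N)) => [|m'|]; last 2 first.
- by rewrite !degE; lia.
- by apply: supp_inX; rewrite -m0 mE /m1 !degE.
rewrite mulr0 add0r mderivX -scalerAr scalerA mulVf ?pnatr_eq0 ?m1l // scale1r.
by rewrite -mpolyXD /m1 addmK addmC -mE.
Qed.

(** With all dual minors zero, the Capelli scalar [udeg m * (vdeg m).+1] must vanish on the support,
    so [f] has u-degree 0. Then [transfer i last f] reduces to [v last * dv i f], and [f] involves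
    no [v i] other than [v last]. *)
Lemma Hgr'_lowest k f : Hgr' k f ->
  (forall i j : 'I_n, (i < j)%N -> dminor i j f = 0) ->
  (forall i, i != last -> transfer i last f = 0) ->
  exists c, f = c *: v last ^+ `|k|%N.
Proof.
move=> fH fd ft.
have f0 : supp_in (fun m => udeg m = 0%N) f.
  apply/supp_inP => m; have := capelli_coef m fH.
  rewrite big1 => [|i _]; last by rewrite big1 // => j ij; rewrite fd ?mulr0.
  rewrite mcoeff0 => /esym/eqP; rewrite !mulf_eq0 !pnatr_eq0 orbF.
  by case/orP=> /eqP; [right | left].
have fv i : i != last -> supp_in (fun m => m (hi i) = 0%N) f.
  move=> il; apply: mderiv_eq0_supp; have := ft i il.
  rewrite /transfer (@mderiv_supp0 _ _ (lo i) f _ f0) => [|m]; last by rewrite !degE; lia.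
  rewrite mulr0 add0r => /eqP; rewrite mulf_eq0 => /orP[|/eqP//].
  by rewrite -msize_poly_eq0 msizeX.
exists (f@_(U_(hi last) *+ `|k|%N)).
have [/AgrP fk _] := fH.
rewrite mpolyXn; apply/mpolyP => m; rewrite mcoeffZ mcoeffX.
have [->|mM] := eqVneq; first by rewrite mulr1.
rewrite mulr0; apply: memN_msupp_eq0; apply: contra mM => mf.
have m0 := f0 _ mf.
have : 'X_[m] = v last ^+ `|k|%N.
  by apply: monomial_v_last => // [|i il]; [rewrite (fk _ mf) m0 add0r | apply: fv].
rewrite mpolyXn => /(congr1 (fun p : A => msupp p)); rewrite !msuppX => -[->].
by rewrite eqxx.
Qed.

(** Starting from a nonzero element, apply operators [dminor i j] and [transfer i last] as long as
    one gives a nonzero result; [Hgr'_lowest] identifies the element where this stops. *)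
Lemma Hgr'_meets k W : so_submodule T W -> (forall f, W f -> Hgr' k f) ->
  forall f, W f -> f <> 0 -> W (v last ^+ `|k|%N).
Proof.
move=> /so_submoduleP[subW Wt Wm Wd] WH f.
(* Both kinds of lowering operators decrease this weighted degree. *)
pose w (a : 'I_(n + n)) := if (a == lo last) || (a == hi last) then 1%N else 2%N.
have w1 a : (0 < w a)%N by rewrite /w; case: ifP.
have wl : w (lo last) = 1%N /\ w (hi last) = 1%N by rewrite /w !eqxx orbT.
have w2 i : i != last -> w (lo i) = 2%N /\ w (hi i) = 2%N.
  move=> /negbTE il; rewrite /w !(inj_eq (@lshift_inj _ _)) !(inj_eq (@rshift_inj _ _)).
  by rewrite eq_lrshift eq_rlshift il.
have [d fd] := wdeg_bound w f.
have {}fd : supp_in (fun m => wdeg w m < d.+1)%N f by move=> m /fd.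
elim: d.+1 f fd => {d} [|d IH] f fd Wf f0.
  by case: f0; apply/mpolyP => m; have [->|//] := (supp_inP _ f).1 fd m; rewrite mcoeff0.
have dwd a b : supp_in (fun m => wdeg w m < d)%N (mderiv a (mderiv b f)).
  apply: (@supp_in_mderiv _ _ (fun m => wdeg w m < d.+1)%N) => [m|].
    by rewrite wdegD wdegU; have := w1 a; lia.
  by apply: supp_in_mderiv fd => m; rewrite wdegD wdegU; have := w1 b; lia.
have dwt a b : w a = 2%N -> w b = 1%N ->
    supp_in (fun m => wdeg w m < d)%N ('X_b * mderiv a f).
  move=> wa wb; apply: (@supp_in_mulX _ _ (fun m => (wdeg w m).+1 < d)%N) => [m|].
    by rewrite wdegD wdegU wb addn1.
  by apply: supp_in_mderiv fd => m; rewrite wdegD wdegU wa; lia.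
case: (boolP [exists i : 'I_n, exists j : 'I_n, (i < j)%N && (dminor i j f != 0)]).
  case/existsP=> i /existsP[j /andP[ij /eqP nz]].
  by apply: (IH (dminor i j f)) nz; [apply: supp_inB; apply: dwd | apply: Wd].
move=> /existsPn nd.
case: (boolP [exists i : 'I_n, (i != last) && (transfer i last f != 0)]).
  case/existsP=> i /andP[il /eqP nz]; have [wa wb] := w2 i il; have [wc wd] := wl.
  by apply: (IH (transfer i last f)) nz; [apply: supp_inD; apply: dwt | apply: Wt].
move=> /existsPn nt.
have [|||c fE] := @Hgr'_lowest k f; first exact: WH.
- move=> i j ij; apply/eqP; move: (nd i) => /existsPn/(_ j).
  by rewrite ij negbK.
- by move=> i il; apply/eqP; move: (nt i); rewrite il negbK.
have c0 : c != 0 by apply/eqP => c0; apply: f0; rewrite fE c0 scale0r.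
have := subspaceZ subW c^-1 Wf.
by rewrite {1}fE scalerA mulVf // scale1r.
Qed.

Lemma v_last_Hgr' k : 0 <= k -> Hgr' k (v last ^+ `|k|%N).
Proof.
move=> k0; rewrite mpolyXn.
have udeg0 : udeg (U_(hi last) *+ `|k|)%MM = 0%N.
  by rewrite /udeg big1 // => i _; rewrite mulmnE mnm1E eq_rlshift.
split.
  apply/AgrP; apply: supp_inX; rewrite udeg0 add0r.
  rewrite /vdeg (bigD1 last) //= mulmnE mnm1E eqxx mul1n big1 ?addn0 ?gez0_abs //.
  move=> i il; rewrite mulmnE mnm1E (inj_eq (@rshift_inj _ _)) eq_sym.
  by rewrite (negbTE il).
rewrite /eta_op big1 // => i _; rewrite (@mderiv_supp0 _ (fun m => udeg m = 0%N)) ?mulr0 //.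
  by move=> m; rewrite !degE; lia.
exact: supp_inX.
Qed.

Lemma Hgr'_generated k W : 0 <= k -> so_submodule T W ->
  W (v last ^+ `|k|%N) -> forall f, Hgr' k f -> W f.
Proof.
move=> k0 /so_submoduleP[subW Wt Wm Wd] Wv; apply: Hgr'_ind => //.
exact: v_monomial_transfer.
Qed.

Lemma v_last_neq0 d : v last ^+ d <> 0 :> A.
Proof. by apply/eqP; rewrite mpolyXn -msize_poly_eq0 msizeX. Qed.

Lemma Hgr'_irreducible k : 0 <= k -> irreducible_module T (@Hgr' C n k).
Proof.
move=> k0; split; first exact: Hgr'_submodule.
  by exists (v last ^+ `|k|%N); split; [exact: v_last_Hgr' | exact: v_last_neq0].
move=> W Wso WH.
(* Submodules are arbitrary predicates, so whether [W] is zero is decided classically. *)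
have [[f Wf /eqP f0]|Wz] := boolp.EM (exists2 f, W f & f != 0).
  by right; apply: Hgr'_generated => //; apply: Hgr'_meets Wf f0.
by left=> f Wf; apply/eqP; apply: contraT => f0; case: Wz; exists f.
Qed.

(** * The weight computation, shared by the powers of [v last] and [u last] *)

Section HighestWeight.
Variables (a : int) (f : A).
Hypotheses (f0 : f <> 0)
  (fd : forall i j : 'I_n, (i < j)%N -> dminor i j f = 0)
  (ft : forall i j : 'I_n, (i < j)%N -> transfer i j f = 0)
  (fh : forall i, transfer i i f = ((i == last)%:R * a%:~R) *: f).

(** The coroots are [n] independent vectors of a space spanned by [n] lines. *)
Lemma span_coroot : <<[tuple coroot C j | j < n]>>%VS = cartan C n.
Proof.
apply/eqP; rewrite eqEdim; apply/andP; split.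
  by apply/span_subvP => x /tnthP[j ->]; rewrite tnth_mktuple coroot_cartan.
rewrite (eqP (coroot_free C hn)) size_tuple.
rewrite /cartan (leq_trans (dimv_leq_sum _ _ _)) //.
rewrite -[X in (_ <= X)%N]card_ord -sum1_card; apply: leq_sum => i _.
by rewrite dim_vline; case: (_ != _).
Qed.

(** Each [vecA i i] acts by -1, with a further [-a] for the last index. The -1 cancels in the
    coroots that are differences and doubles in the last one, which is a sum: hence [a] at the
    penultimate index and [-(a + 2)] at the last. *)
Lemma glact_coroot j : glact T (coroot C j) f =
  (a%:~R * (j == idx_penult hn)%:R - (a + 2)%:~R * (j == last)%:R) *: f.
Proof.
have lastE (i : 'I_n) : (i == last) = (i.+1 == n) by rewrite -val_eqE /=; lia.
have penE (i : 'I_n) : (i == idx_penult hn) = (i.+2 == n) by rewrite -val_eqE /=; lia.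
have AE i : glact T (vecA C i i) f = (- ((i == last)%:R * a%:~R) - 1) *: f.
  by rewrite glact_vecA fh eqxx scale1r scalerBl scale1r scaleNr.
rewrite /coroot; case: ifP => jn.
  rewrite glactBl !AE -scalerBl !lastE penE /= modn_small // (ltn_eqF jn).
  by rewrite mul0r mulr0 subr0 oppr0 sub0r opprB addrA addNr add0r opprK mulrC.
have jl : j.+1 = n by have := ltn_ord j; lia.
rewrite glactDl !AE -scalerDl !lastE penE jl eqxx /=.
(* The value of [ord_pred] at the last index. *)
have -> : ((j + n).-1 %% n)%N = n.-2.
  by rewrite (_ : (j + n).-1 = n.-2 + n)%N ?modnDr ?modn_small //; lia.
have -> : (n.-2.+1 == n) = false by lia.
have -> : (n.+1 == n) = false by lia.
by rewrite intrD mul0r mul1r mulr0 mulr1; congr (_ *: _); ring.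
Qed.

Lemma highest_weight_vectorP :
  highest_weight_vector T
    (a%:~R *: fund_weight C (idx_penult hn) - (a + 2)%:~R *: fund_weight C last) f.
Proof.
split=> // [h|g gp]; last first.
  (* The span of the empty set serves as the zero subspace, so that vanishing can be checked on
     generators of [so_pos]. *)
  have sQ := glact_subspace f (lspan_subspace (fun _ : A => False)).
  have Z (x : A) : lspan (fun _ : A => False) x -> x = 0.
    by move=> [s [c [sF ->]]]; rewrite big_seq big1 // => b /sF.
  apply: Z; move: g gp.
  apply: (sumv_subspace sQ) => i _; apply: (sumv_subspace sQ) => j ij.
  have z0 : lspan (fun _ : A => False) 0 by exact: subspace0 (lspan_subspace _).
  apply: (addv_subspace sQ); apply: (vline_subspace sQ).
    rewrite glact_vecA ft // (_ : (i == j) = false) ?scale0r ?oppr0 ?addr0 //.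
    by rewrite -val_eqE /= ltn_eqF.
  by rewrite glact_vecB fd.
have hE : vsval h \in <<[tuple coroot C j | j < n]>>%VS by rewrite span_coroot subvsP.
have [c ->] : exists c, h = \sum_(j < n) c j *: vsproj (cartan C n) (coroot C j).
  exists (fun j => coord [tuple coroot C j | j < n] j (vsval h)).
  rewrite -[LHS](vsvalK) {1}(coord_span hE) linear_sum; apply: eq_bigr => j _.
  by rewrite linearZ -tnth_nth tnth_mktuple.
have gs : glact T (vsval (\sum_(j < n) c j *: vsproj (cartan C n) (coroot C j))) f
    = \sum_(j < n) c j *: glact T (coroot C j) f.
  rewrite linear_sum /=; elim/big_rec2: _ => [|j y z _ <-]; first exact: glact0l.
  by rewrite glactDl glactZl vsprojK ?coroot_cartan.
rewrite gs linear_sum scaler_suml; apply: eq_bigr => j _.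
rewrite linearZ -scalerA glact_coroot; congr (_ *: (_ *: _)).
rewrite /= add_lfunE opp_lfunE !scale_lfunE !(fund_weightP C hn).
by rewrite eq_sym [last == _]eq_sym.
Qed.

End HighestWeight.
End Irreducibility.

(** * Linear independence from distinct leading monomials *)

Section Leads.
Variables (C : fieldType) (N : nat) (X : {mpoly C[N]} -> Prop).

Lemma mlead_max (p : {mpoly C[N]}) (s : seq {mpoly C[N]}) :
  exists2 q, q \in p :: s & forall r, r \in p :: s -> (mlead r <= mlead q)%O.
Proof.
elim: s p => [|p' s IH] p; first by exists p => [|r]; rewrite inE // => /eqP->.
have [q qs qmax] := IH p'; have [le|le] := leP (mlead p) (mlead q).
  exists q => [|r]; first by rewrite inE qs orbT.
  by rewrite inE => /predU1P[->|/qmax].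
exists p => [|r]; first exact: mem_head.
by rewrite inE => /predU1P[->//|/qmax rq]; apply: le_trans rq (ltW le).
Qed.

(** Among the vectors with nonzero coefficient, take one with the largest leading monomial: no other
    contributes to that monomial, so it cannot cancel. *)
Lemma lin_indep_mlead :
  (forall f, X f -> f != 0) ->
  (forall f g, X f -> X g -> mlead f = mlead g -> f = g) -> lin_indep X.
Proof.
move=> X0 Xinj s c us sX sum0 b bs; apply/eqP; apply: contraT => cb.
have : b \in [seq x <- s | c x != 0] by rewrite mem_filter cb.
move fsE: [seq x <- s | c x != 0] => fs; case: fs fsE => // y r fsE _.
have [b0 + b0max] := mlead_max y r.
rewrite -fsE mem_filter => /andP[cb0 b0s].
have := congr1 (mcoeff (mlead b0)) sum0; rewrite mcoeff0 raddf_sum /= (bigD1_seq b0) //=.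
rewrite big1_seq => [|x /andP[xb xs]]; last first.
  rewrite mcoeffZ; have [->|cx] := eqVneq (c x) 0; first by rewrite mul0r.
  rewrite mcoeff_gt_mlead ?mulr0 // lt_neqAle b0max ?andbT -?fsE ?mem_filter ?cx //.
  by apply: contraNneq xb => /Xinj -> //; apply: sX.
rewrite addr0 mcoeffZ => /eqP; rewrite mulf_eq0 (negbTE cb0) mleadc_eq0.
by rewrite (negbTE (X0 _ (sX _ b0s))).
Qed.

End Leads.

(** * Passage between exponents and lists with multiplicities *)

Section Multiplicities.
Variable T : finType.

Lemma count_sum (a : pred T) (s : seq T) :
  count a s = (\sum_(x | a x) count_mem x s)%N.
Proof.
elim: s => [|y s IH] /=; first by rewrite big1.
rewrite big_split /= -IH; congr (_ + _)%N.
rewrite big_mkcond (bigD1 y) //= eqxx big1 ?addn0; first by case: (a y).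
by move=> x; rewrite eq_sym => /negbTE->; rewrite if_same.
Qed.

Lemma prod_count (R : comNzRingType) (F : T -> R) (s : seq T) :
  \prod_(x <- s) F x = \prod_x F x ^+ count_mem x s.
Proof.
elim: s => [|y s IH]; first by rewrite big_nil big1.
rewrite big_cons /= IH; under [RHS]eq_bigr => x _ do rewrite exprD.
rewrite big_split /=; congr (_ * _).
rewrite (bigD1 y) //= eqxx expr1 big1 ?mulr1 // => x.
by rewrite eq_sym => /negbTE->; rewrite expr0.
Qed.

Definition seq_of_mult (kappa : T -> nat) : seq T :=
  flatten [seq nseq (kappa x) x | x <- enum T].

Lemma count_seq_of_mult kappa x : count_mem x (seq_of_mult kappa) = kappa x.
Proof.
rewrite /seq_of_mult count_flatten -map_comp sumnE big_map big_enum /=.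
rewrite (bigD1 x) //= count_nseq /= eqxx mul1n big1 ?addn0 // => y yx.
by rewrite count_nseq /= (negbTE yx) mul0n.
Qed.

Lemma mem_count (s : seq T) x : (x \in s) = (count_mem x s != 0%N).
Proof. by rewrite -has_pred1 has_count lt0n. Qed.

End Multiplicities.

(** * Products of brackets and their straightening *)

Section Tableaux.
Variables (C : numFieldType) (n : nat).
Local Notation A := {mpoly C[n + n]}.
Local Notation lo i := (lshift n i).
Local Notation hi i := (rshift n i).
Local Notation u i := ('X_(lo i) : A).
Local Notation v i := ('X_(hi i) : A).
Local Notation col := ('I_n.+1 * 'I_n.+1)%type.
Local Notation star := (ord0 : 'I_n.+1).
Local Notation ix i := (lift ord0 i).
Implicit Types (p q : col) (s t : seq col) (f g : A).

(* The variables [v t] are treated as further minors, with an extra smallest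
   index [ord0] whose [u]- and [v]-variables are specialised to 1 and 0. *)
Definition uvar (a : 'I_n.+1) : A := if unlift star a is Some i then u i else 1.
Definition vvar (a : 'I_n.+1) : A := if unlift star a is Some i then v i else 0.
Definition brk p : A := uvar p.1 * vvar p.2 - uvar p.2 * vvar p.1.
Definition brks s : A := \prod_(p <- s) brk p.

Definition colwf s := all (fun p => p.1 < p.2)%N s.
Definition stars s := count (fun p => p.1 == star) s.
(** Strict inclusion of intervals. As [star] is the smallest index, this one relation covers both
    vanishing conditions on exponents: [i < j < t] says that [(star, ix t)] strictly contains
    [(ix i, ix j)]. *)
Definition nested p q := (p.1 < q.1)%N && (q.2 < p.2)%N.
Definition standard s := all (fun p => all (fun q => ~~ nested p q) s) s.

Lemma bump0 k : bump 0 k = k.+1. Proof. by []. Qed.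

Lemma uvar_star : uvar star = 1. Proof. by rewrite /uvar unlift_none. Qed.
Lemma vvar_star : vvar star = 0. Proof. by rewrite /vvar unlift_none. Qed.
Lemma uvar_lift i : uvar (ix i) = u i. Proof. by rewrite /uvar liftK. Qed.
Lemma vvar_lift i : vvar (ix i) = v i. Proof. by rewrite /vvar liftK. Qed.

Lemma brk_star i : brk (star, ix i) = v i.
Proof. by rewrite /brk uvar_star vvar_star vvar_lift mul1r mulr0 subr0. Qed.

Lemma brk_lift i j : brk (ix i, ix j) = minor C i j.
Proof. by rewrite /brk /= !uvar_lift !vvar_lift. Qed.

Variant col_spec : col -> Type :=
| ColStar i : col_spec (star, ix i)
| ColLift (i j : 'I_n) of (i < j)%N : col_spec (ix i, ix j).

Lemma colP p : (p.1 < p.2)%N -> col_spec p.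
Proof.
case: p => a b /=; case: (unliftP star b) => [j|] -> //.
case: (unliftP star a) => [i|] -> ab; last exact: ColStar.
by apply: ColLift; move: ab; rewrite /= !bump0.
Qed.

(** The three-term Pluecker relation. It holds for arbitrary values of the variables, hence also
    when an index is [star]. *)
Lemma plucker a b c d :
  brk (a, d) * brk (b, c) = brk (a, c) * brk (b, d) - brk (a, b) * brk (c, d).
Proof. by rewrite /brk /=; ring. Qed.

Lemma brks_cons p s : brks (p :: s) = brk p * brks s.
Proof. exact: big_cons. Qed.

Lemma perm_brks s t : perm_eq s t -> brks s = brks t.
Proof. exact: perm_big. Qed.

(** The termination measure of straightening: squares penalise one long column around a short
    one. *)
Definition spread s := (\sum_(p <- s) (p.2 - p.1) ^ 2)%N.

(** With [X], [Y], [Z] the successive gaps, the right side exceeds the first sum by [2XZ] and the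
    second by [2XZ + 2Y(X + Y + Z)]. *)
Lemma uncross_sqr (a b c d : nat) : (a < b)%N -> (b < c)%N -> (c < d)%N ->
  ((c - a) ^ 2 + (d - b) ^ 2 < (d - a) ^ 2 + (c - b) ^ 2)%N /\
  ((b - a) ^ 2 + (d - c) ^ 2 < (d - a) ^ 2 + (c - b) ^ 2)%N.
Proof.
move=> /subnKC <-; move: (b - a.+1)%N => x {b} /subnKC <-; move: (c - _)%N => y {c}.
move=> /subnKC <-; move: (d - _)%N => z {d}.
have -> : (a.+1 + x - a = x.+1)%N by lia.
have -> : ((a.+1 + x).+1 + y - a = x.+1 + y.+1)%N by lia.
have -> : ((a.+1 + x).+1 + y - (a.+1 + x) = y.+1)%N by lia.
have -> : (((a.+1 + x).+1 + y).+1 + z - a = x.+1 + y.+1 + z.+1)%N by lia.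
have -> : (((a.+1 + x).+1 + y).+1 + z - (a.+1 + x) = y.+1 + z.+1)%N by lia.
have -> : (((a.+1 + x).+1 + y).+1 + z - ((a.+1 + x).+1 + y) = z.+1)%N by lia.
move: x.+1 (ltn0Sn x) y.+1 z.+1 (ltn0Sn z) => X X0 Y Z Z0.
have XZ : (0 < X * Z)%N by rewrite muln_gt0 X0.
by split; rewrite !sqrnD mulnDl; lia.
Qed.

(** Induction on [spread]. A nested pair is replaced through [plucker] by two pairs of smaller
    spread. The number of stars is kept, because of the four indices involved only the smallest can
    be [star] and it stays a first entry. *)
Lemma straightening s : colwf s ->
  lspan (fun f => exists t, [/\ colwf t, stars t = stars s, standard t & f = brks t]) (brks s).
Proof.
have [N] := ubnP (spread s); elim: N s => // N IH s sN wfs.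
case: (boolP (standard s)) => [std|]; first by apply: lspan_gen; exists s.
case/allPn=> p ps /allPn[q qs /negPn pq].
have qp : q != p by apply: contraTneq pq => ->; rewrite /nested ltnn.
have /(perm_trans (perm_to_rem ps)) sE : perm_eq (p :: rem p s) [:: p, q & rem q (rem p s)].
  rewrite perm_cons; apply: perm_to_rem.
  by move: qs; rewrite (perm_mem (perm_to_rem ps)) inE (negbTE qp).
move: (rem q (rem p s)) pq sE => r {ps qs qp}.
case: p q => [a d] [b c] /andP[/= ab cd] sE.
have [bc wfr] : (b < c)%N /\ colwf r.
  by move: wfs; rewrite /colwf (perm_all _ sE) /= => /and3P[].
have b0 : (b == star) = false by rewrite -val_eqE /=; lia.
have c0 : (c == star) = false by rewrite -val_eqE /=; lia.
have starsE : stars s = ((a == star) + stars r)%N.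
  by rewrite /stars (permP sE) /= b0.
have [sub0 subP] := lspan_subspace
  (fun f => exists t, [/\ colwf t, stars t = stars s, standard t & f = brks t]).
have red t : (spread t < spread s)%N -> colwf t -> stars t = stars s ->
    lspan (fun f => exists t, [/\ colwf t, stars t = stars s, standard t & f = brks t]) (brks t).
  by move=> ts wft <-; apply: IH => //; apply: leq_trans ts _.
have -> : brks s = -1 *: brks [:: (a, b), (c, d) & r] + brks [:: (a, c), (b, d) & r].
  rewrite (perm_brks sE) !brks_cons !mulrA plucker scaleN1r mulrBl addrC.
  by [].
have [sq1 sq2] := uncross_sqr ab bc cd.
have spE : spread s = ((d - a) ^ 2 + ((c - b) ^ 2 + spread r))%N.
  by rewrite /spread (perm_big _ sE) !big_cons.
apply: subP; apply: red.
- by rewrite spE /spread !big_cons /= !addnA ltn_add2r.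
- by rewrite /= ab cd.
- by rewrite starsE /stars /= c0.
- by rewrite spE /spread !big_cons /= !addnA ltn_add2r.
- by rewrite /= (ltn_trans ab bc) (ltn_trans bc cd).
- by rewrite starsE /stars /= b0.
Qed.

Lemma brks_mult s : colwf s ->
  brks s = (\prod_(t < n) v t ^+ count_mem (star, ix t) s) *
    \prod_(i < n) \prod_(j < n | (i < j)%N) minor C i j ^+ count_mem (ix i, ix j) s.
Proof.
move=> wfs; have z p : (p.2 <= p.1)%N -> brk p ^+ count_mem p s = 1.
  move=> pp; rewrite (count_memPn _) ?expr0 //; apply: contraTN pp => ps.
  by rewrite -ltnNge (allP wfs).
rewrite /brks prod_count -(pair_bigA _ (fun a b => brk (a, b) ^+ count_mem (a, b) s)) /=.
rewrite big_ord_recl; congr (_ * _).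
  rewrite big_ord_recl z // mul1r; apply: eq_bigr => t _; by rewrite brk_star.
apply: eq_bigr => i _; rewrite big_ord_recl z // mul1r [RHS]big_mkcond.
apply: eq_bigr => j _; rewrite brk_lift; case: ltnP => // ji.
by rewrite -brk_lift z //= !bump0.
Qed.

Lemma stars_mult s : colwf s -> stars s = (\sum_(t < n) count_mem (star, ix t) s)%N.
Proof.
move=> wfs; rewrite /stars count_sum (eq_bigl (fun p => (p.1 == star) && true)) => [|p]; last first.
  by rewrite andbT.
rewrite -(pair_big_dep (fun a => a == star) (fun _ _ => true)
  (fun a b => count_mem (a, b) s)) /= big_pred1_eq big_ord_recl.
rewrite (count_memPn _) //; apply/negP => /(allP wfs); by rewrite /= ltnn.
Qed.

(** A dictionary: the exponents [kt t] and [kk i j] are the multiplicities of the columns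
    [(star, ix t)] and [(ix i, ix j)], and the vanishing products say that no two nested columns
    both occur. *)
Lemma standard_brks (d : nat) f :
  standard_monomials (fun t : 'I_n => v t) d f <->
  exists t, [/\ colwf t, stars t = d, standard t & f = brks t].
Proof.
split=> [[kt [kk [ktd ktk kkk ->]]]|[s [wfs sd std ->]]]; last first.
  exists (fun l => count_mem (star, ix l) s), (fun i j => count_mem (ix i, ix j) s).
  have mul0 p q : nested p q -> (count_mem p s * count_mem q s = 0)%N.
    move=> pq; apply/eqP; rewrite muln_eq0; apply: contraTT pq.
    rewrite negb_or -!mem_count => /andP[ps qs].
    exact: (allP (allP std _ ps) _ qs).
  split; first by rewrite -stars_mult // sd.
  - by move=> i j t ij jt; rewrite mulnC mul0 // /nested /= !bump0.
  - by move=> i j i1 j1 ij ij1 ii jj; rewrite mul0 // /nested /= !bump0 ltnS ii ltnS.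
  - exact: brks_mult.
(* The value 0 for [i >= j] is imposed, since [kk] is unconstrained there. *)
pose kappa p := match unlift star p.1, unlift star p.2 with
  | None, Some t => kt t
  | Some i, Some j => if (i < j)%N then kk i j else 0%N
  | _, None => 0%N end.
have kS l : kappa (star, ix l) = kt l by rewrite /kappa unlift_none liftK.
have kL (i j : 'I_n) : kappa (ix i, ix j) = if (i < j)%N then kk i j else 0%N.
  by rewrite /kappa !liftK.
pose s := seq_of_mult kappa.
have cs p : count_mem p s = kappa p := count_seq_of_mult kappa p.
have wfs : colwf s.
  apply/allP => -[a b]; rewrite mem_count cs /kappa /=.
  case: (unliftP star b) => [j|] -> //; case: (unliftP star a) => [i|] -> //.
  by rewrite /= !bump0 ltnS; case: ifP.
exists s; split=> //.
- apply/eqP; rewrite -eqz_nat -ktd stars_mult //; apply/eqP; congr Posz.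
  by apply: eq_bigr => t _; rewrite cs kS.
- apply/allP => p ps; apply/allP => q qs; apply/negP.
  have /colP pw := allP wfs _ ps; have /colP qw := allP wfs _ qs.
  move: ps qs; rewrite !mem_count !cs; case: pw => [t|i j ij]; case: qw => [t'|i1 j1 ij1].
  + by rewrite /nested ltnn.
  + rewrite kS kL ij1 /nested /= !bump0 => kt0 kk0 jt.
    by have := ktk i1 j1 t ij1 jt => /eqP; rewrite muln_eq0 (negbTE kt0) (negbTE kk0).
  + by rewrite /nested ltn0.
  + rewrite !kL ij ij1 /nested /= !bump0 !ltnS => k0 k1 /andP[ii jj].
    by have := kkk _ _ _ _ ij ij1 ii jj => /eqP; rewrite muln_eq0 (negbTE k0) (negbTE k1).
- rewrite brks_mult //; congr (_ * _); first by apply: eq_bigr => t _; rewrite cs kS.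
  by apply: eq_bigr => i _; apply: eq_bigr => j ij; rewrite cs kL ij.
Qed.

End Tableaux.

(** * Standard products form a basis of the kernel of [eta] in nonnegative degree *)

Section StandardBasis.
Variables (C : numFieldType) (n : nat).
Local Notation A := {mpoly C[n + n]}.
Local Notation lo i := (lshift n i).
Local Notation hi i := (rshift n i).
Local Notation u i := ('X_(lo i) : A).
Local Notation v i := ('X_(hi i) : A).
Local Notation col := ('I_n.+1 * 'I_n.+1)%type.
Local Notation star := (ord0 : 'I_n.+1).
Local Notation ix i := (lift ord0 i).
Local Notation brk := (@brk C n).
Local Notation brks := (@brks C n).
Implicit Types (p q : col) (s : seq col) (f g : A).

Lemma brks_Hgr' s : colwf s -> Hgr' (stars s) (brks s).
Proof.
elim: s => [_|p s IH].
  rewrite /brks big_nil; split.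
    apply/AgrP; rewrite -mpolyX0; apply: supp_inX.
    by rewrite /vdeg /udeg !big1 // => i _; rewrite mnm0E.
  by rewrite /eta_op big1 // => i _; rewrite -mpolyC1 mderivC mulr0.
case/andP=> /colP pw wfs; have [fk f0] := IH wfs; rewrite brks_cons.
case: pw => [i|i j ij]; rewrite ?brk_star ?brk_lift; last exact: Hgr'_minor.
split; last by rewrite eta_mulv f0 mulr0.
by rewrite /stars /= add1n -addn1 PoszD; apply: Agr_mulv.
Qed.

Lemma v_monomial_brks (m : 'X_{1..n + n}) : udeg m = 0%N ->
  exists s, [/\ colwf s, stars s = vdeg m & 'X_[m] = brks s].
Proof.
move=> m0.
pose kappa p := if unlift star p.1 is None then
  if unlift star p.2 is Some t then m (hi t) else 0%N else 0%N.
pose s := seq_of_mult kappa.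
have cs p : count_mem p s = kappa p := count_seq_of_mult kappa p.
have wfs : colwf s.
  apply/allP => -[a b]; rewrite mem_count cs /kappa /=.
  by case: (unliftP star a) => [i|] ->; case: (unliftP star b) => [j|] ->.
have csS l : count_mem (star, ix l) s = m (hi l) by rewrite cs /kappa unlift_none liftK.
exists s; split=> //; first by rewrite stars_mult //; apply: eq_bigr => t _.
rewrite brks_mult // [X in _ = _ * X]big1 => [|i _]; last first.
  by rewrite big1 // => j _; rewrite cs /kappa liftK expr0.
rewrite mulr1 mpolyXE_id big_split_ord /= big1 ?mul1r => [|i _]; last first.
  by rewrite udeg_eq0.
by apply: eq_bigr => i _; rewrite csS.
Qed.

(** Products of brackets with [d] stars include the monomials in the [v t] and are stable under
    minors, so [Hgr'_ind] shows that they span; [straightening] then makes them standard. *)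
Lemma Hgr'_span (d : nat) f : Hgr' d f ->
  lspan (standard_monomials (fun t : 'I_n => v t) d) f.
Proof.
pose W0 := lspan (fun g : A => exists s, [/\ colwf s, stars s = d & g = brks s]).
have sW0 : subspace W0 by apply: lspan_subspace.
move=> fH; suff: W0 f.
  apply: lspan_sub; first exact: lspan_subspace.
  move=> _ [s [wfs sd ->]]; have := straightening C wfs; apply: lspan_sub.
    exact: lspan_subspace.
  by move=> g gP; apply: lspan_gen; apply/standard_brks; rewrite -sd.
apply: Hgr'_ind fH => // [m m0 [md]|i j g ij].
  by apply: lspan_gen; have [s [wfs ss ->]] := v_monomial_brks m0; exists s; split=> //; rewrite ss.
apply: (@lspan_sub _ _ (fun g => W0 (minor C i j * g))).
  split=> [|a g1 g2 Wg1 Wg2]; first by rewrite mulr0; apply: subspace0.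
  by rewrite mulrDr -scalerAr; apply: subspaceD => //; apply: subspaceZ.
move=> _ [s [wfs sd ->]]; apply: lspan_gen; exists ((ix i, ix j) :: s).
by split; rewrite /= ?wfs ?andbT // brks_cons brk_lift.
Qed.

(** The diagonal term of the bracket; a first entry [star] contributes the factor 1. *)
Definition lead_col p : 'X_{1..n + n} :=
  ((if unlift star p.1 is Some i then U_(lo i) else 0) +
   (if unlift star p.2 is Some j then U_(hi j) else 0))%MM.

Lemma mlead_brk p : (p.1 < p.2)%N -> mlead (brk p) = lead_col p /\ brk p != 0.
Proof.
case/colP=> [i|i j ij]; rewrite ?brk_star ?brk_lift /lead_col ?unlift_none !liftK /=.
  by rewrite add0m mleadXm -msize_poly_eq0 msizeX.
(* The degrees agree and, as [i < j], the first variable whose exponents differ is [lo i]. *)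
have lt_m : (U_(lo j) + U_(hi i) < U_(lo i) + U_(hi j) :> 'X_{1..n + n})%MM%O.
  apply/ltmcP; first by rewrite !mdegD !mdeg1.
  exists (lo i) => [l li|].
    rewrite !mnmDE !mnm1E -!val_eqE /=; move: li ij (ltn_ord i) => /=; lia.
  rewrite !mnmDE !mnm1E eqxx (inj_eq (@lshift_inj _ _)) !eq_rlshift.
  by rewrite -val_eqE /= gtn_eqF.
have le : mlead (minor C i j) = (U_(lo i) + U_(hi j))%MM.
  by rewrite /minor -!mpolyXD mleadDl ?mleadN !mleadXm.
split=> //; apply/eqP => z; move: le; rewrite z mlead0 => /mnmP/(_ (lo i)).
by rewrite mnmDE mnm0E !mnm1E eqxx.
Qed.

Lemma brks_neq0 s : colwf s -> brks s != 0.
Proof.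
move=> wfs; rewrite /brks prodf_seq_neq0; apply/allP => p ps.
by case: (mlead_brk (allP wfs _ ps)).
Qed.

Lemma mlead_brks s : colwf s -> mlead (brks s) = (\sum_(p <- s) lead_col p)%MM.
Proof.
move=> wfs; rewrite /brks mlead_prod => [|p ps _]; last by case: (mlead_brk (allP wfs _ ps)).
by apply: eq_big_seq => p ps; case: (mlead_brk (allP wfs _ ps)).
Qed.

Lemma mlead_brks_lo s i : colwf s ->
  mlead (brks s) (lo i) = count_mem (ix i) (unzip1 s).
Proof.
move=> /mlead_brks ->; rewrite mnm_sumE -sum1_count big_map [RHS]big_mkcond.
apply: eq_bigr => -[a b] _; rewrite /lead_col mnmDE /=.
case: (unliftP star a) => [a'|] ->; case: (unlift star b) => [b'|];
  rewrite ?mnm0E ?mnm1E ?eq_rlshift ?addn0 ?(inj_eq (@lshift_inj _ _)) ?(inj_eq lift_inj) //.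
Qed.

Lemma mlead_brks_hi s i : colwf s ->
  mlead (brks s) (hi i) = count_mem (ix i) (unzip2 s).
Proof.
move=> /mlead_brks ->; rewrite mnm_sumE -sum1_count big_map [RHS]big_mkcond.
apply: eq_bigr => -[a b] _; rewrite /lead_col mnmDE /=.
case: (unlift star a) => [a'|]; case: (unliftP star b) => [b'|] ->;
  rewrite ?mnm0E ?mnm1E ?eq_lrshift ?add0n ?(inj_eq (@rshift_inj _ _)) ?(inj_eq lift_inj) //.
Qed.

Definition col_le p q := (p.1 < q.1)%N || (p.1 == q.1) && (p.2 <= q.2)%N.

Lemma col_le_total : total col_le.
Proof. move=> [a b] [c d]; rewrite /col_le /= -!val_eqE /=; lia. Qed.

(* A standard list, once sorted lexicographically, is sorted in both
   coordinates, hence recovered from the multisets of its coordinates. *)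
Lemma standard_sorted s : standard s ->
  sorted (relpre val leq) (unzip1 (sort col_le s)) /\
  sorted (relpre val leq) (unzip2 (sort col_le s)).
Proof.
move=> std; have srt := sort_sorted col_le_total s.
have all_s : all (mem s) (sort col_le s) by apply/allP => p; rewrite mem_sort.
split; rewrite sorted_map; apply: sub_in_sorted all_s srt => -[a b] [c d] ps qs.
  by rewrite /col_le /= -val_eqE; case: ltngtP => //.
rewrite /col_le /=; case/orP => [ac|/andP[]//].
by rewrite leqNgt; have := allP (allP std _ ps) _ qs; rewrite /nested /= ac.
Qed.

(** The leading monomial records how often each index other than [star] occurs as first and as
    second entry; [stars] supplies the missing count for first entries, and [star] is never a second
    entry. By [standard_sorted] these multisets determine the sorted list. *)
Lemma standard_mlead_inj s s' : colwf s -> colwf s' -> standard s -> standard s' ->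
  stars s = stars s' -> mlead (brks s) = mlead (brks s') -> brks s = brks s'.
Proof.
move=> wf wf' std std' ss mm.
have le_asym : antisymmetric (relpre val leq : rel 'I_n.+1).
  by move=> a b /= ab; apply/val_inj/anti_leq.
have le_trans : transitive (relpre val leq : rel 'I_n.+1).
  by move=> a b c /=; apply: leq_trans.
have perm_unzip (h : col -> 'I_n.+1) :
    (forall a, count_mem a (map h s) = count_mem a (map h s')) ->
    perm_eq (map h (sort col_le s)) (map h (sort col_le s')).
  move=> hc; apply: perm_trans (perm_map _ _) _; first exact/permPl/perm_sort.
  rewrite perm_sym; apply: perm_trans (perm_map _ _) _; first exact/permPl/perm_sort.
  by apply/allP => a _ /=; rewrite hc.
have c2 t : colwf t -> count_mem star (unzip2 t) = 0%N.
  by move=> wft; apply/count_memPn/negP => /mapP[p /(allP wft) + E]; rewrite -E.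
have [s1 s2] := standard_sorted std; have [s1' s2'] := standard_sorted std'.
have E : sort col_le s = sort col_le s'.
  rewrite -[LHS]zip_unzip -[RHS]zip_unzip; congr zip.
    apply: (sorted_eq le_trans le_asym) => //; apply: perm_unzip => a.
    case: (unliftP star a) => [i|] ->; first by rewrite -!mlead_brks_lo // mm.
    by move: ss; rewrite /stars !count_map.
  apply: (sorted_eq le_trans le_asym) => //; apply: perm_unzip => a.
  case: (unliftP star a) => [i|] ->; first by rewrite -!mlead_brks_hi // mm.
  by rewrite !c2.
have /(perm_brks C) <- : perm_eq (sort col_le s) s by exact/permPl/perm_sort.
by rewrite E; apply/perm_brks/permPl/perm_sort.
Qed.

Lemma Hgr'_basis (d : nat) :
  is_basis (standard_monomials (fun t : 'I_n => v t) d) (@Hgr' C n d).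
Proof.
split=> [f|].
  split; first exact: Hgr'_span.
  move: f; apply: lspan_sub; first exact: Hgr'_subspace.
  by move=> f /standard_brks[s [wfs <- _ ->]]; apply: brks_Hgr'.
apply: lin_indep_mlead => [f|f g].
  by move=> /standard_brks[s [wfs _ _ ->]]; apply: brks_neq0.
move=> /standard_brks[s [wfs sd std ->]] /standard_brks[t [wft td tstd ->]].
by apply: standard_mlead_inj => //; rewrite sd td.
Qed.

End StandardBasis.

(** * Transport to negative degree by a rotation of the variables *)

Section Transport.
Variables (C : numFieldType) (n : nat).
Local Notation A := {mpoly C[n + n]}.
Local Notation lo i := (lshift n i).
Local Notation hi i := (rshift n i).
Local Notation u i := ('X_(lo i) : A).
Local Notation v i := ('X_(hi i) : A).
Local Notation du i := (mderiv (lo i)).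
Local Notation dv i := (mderiv (hi i)).
Local Notation T := (Tlow n).
Implicit Types (f g : A) (m : 'X_{1..n + n}) (W : A -> Prop).

Lemma mnm_ind (N : nat) (P : 'X_{1..N} -> Prop) :
  P 0%MM -> (forall i (m : 'X_{1..N}), P m -> P (U_(i) + m)%MM) ->
  forall m : 'X_{1..N}, P m.
Proof.
move=> P0 PS m; have [d] := ubnP (mdeg m); elim: d m => // d IH m md.
have [->//|m0] := eqVneq m 0%MM.
have [i mi] : exists i, m i != 0%N.
  apply/existsP; apply: contraR m0 => /existsPn h; apply/eqP/mnmP => i.
  by rewrite mnm0E; apply/eqP; rewrite -[_ == _]negbK.
have mE : m = (U_(i) + (m - U_(i)))%MM by rewrite addmC submK // lep1mP.
rewrite mE; apply/PS/IH; move: md; rewrite {1}mE mdegD mdeg1; lia.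
Qed.

Lemma mpoly_alg_ind W : subspace W -> W 1 ->
  (forall i f, W f -> W (u i * f)) -> (forall i f, W f -> W (v i * f)) -> forall f, W f.
Proof.
move=> sW W1 Wu Wv f; apply: (@supp_in_ind _ _ (fun=> True)) => // m _.
elim/mnm_ind: m => [|a m IH]; first by rewrite mpolyX0.
by rewrite mpolyXD -[a]splitK; case: (split a) => i; [apply: Wu | apply: Wv].
Qed.

(** The sign makes the substitution on each pair [(u i, v i)] have determinant one, so that minors
    are fixed. The resulting automorphism has fourth power the identity, which is why its cube
    [unswap] is the inverse. *)
Definition swap_tuple : (n + n).-tuple A :=
  [tuple (match split a with inl i => - v i | inr i => u i end) | a < n + n].

Definition swap f : A := f \mPo swap_tuple.

Lemma swap_is_linear : linear swap.
Proof. by move=> a f g; rewrite /swap comp_mpolyD comp_mpolyZ. Qed.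
HB.instance Definition _ := GRing.isLinear.Build C A A _ swap swap_is_linear.

HB.instance Definition _ := GRing.RMorphism.copy swap (comp_mpoly swap_tuple).

Lemma swap1 : swap 1 = 1. Proof. exact: rmorph1. Qed.
Lemma swapM f g : swap (f * g) = swap f * swap g. Proof. exact: rmorphM. Qed.

Lemma swap_u i : swap (u i) = - v i.
Proof.
rewrite /swap comp_mpolyXU -tnth_nth tnth_mktuple.
by rewrite (unsplitK (inl i)).
Qed.

Lemma swap_v i : swap (v i) = u i.
Proof.
rewrite /swap comp_mpolyXU -tnth_nth tnth_mktuple.
by rewrite (unsplitK (inr i)).
Qed.

Lemma swapMu i f : swap (u i * f) = - (v i * swap f).
Proof. by rewrite swapM swap_u mulNr. Qed.

Lemma swapMv i f : swap (v i * f) = u i * swap f.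
Proof. by rewrite swapM swap_v. Qed.

Lemma du_swap i f : du i (swap f) = swap (dv i f).
Proof.
apply: (@mpoly_alg_ind (fun f => du i (swap f) = swap (dv i f))) => [||j g IH|j g IH].
- split=> [|a g h E1 E2]; first by rewrite !linear0.
  by rewrite (linearP swap) /= !mderivD !mderivZ (linearP swap) /= E1 E2.
- by rewrite swap1 -mpolyC1 !mderivC linear0.
- by rewrite swapMu mderivN du_mulv IH dv_mulu swapMu.
- rewrite swapMv du_mulu IH dv_mulv (linearD swap) /= swapMv swapM; congr (_ * _ + _).
  by case: (i == j); rewrite ?swap1 ?linear0.
Qed.

Lemma dv_swap i f : dv i (swap f) = - swap (du i f).
Proof.
apply: (@mpoly_alg_ind (fun f => dv i (swap f) = - swap (du i f))) => [||j g IH|j g IH].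
- split=> [|a g h E1 E2]; first by rewrite !linear0 ?oppr0.
  rewrite (linearP swap) /= !mderivD !mderivZ (linearP swap) /= E1 E2.
  by rewrite opprD scalerN.
- by rewrite swap1 -mpolyC1 !mderivC linear0 ?oppr0.
- rewrite swapMu mderivN dv_mulv IH du_mulu (linearD swap) /= swapMu swapM mulrN opprD.
  rewrite opprK opprD opprK; congr (- (_ * _) + _).
  by case: (i == j); rewrite ?swap1 ?linear0.
- by rewrite swapMv dv_mulu IH du_mulv swapMv mulrN.
Qed.

Lemma swap_du i f : swap (du i f) = - dv i (swap f).
Proof. by rewrite dv_swap opprK. Qed.

Lemma swap4 f : swap (swap (swap (swap f))) = f.
Proof.
apply: (@mpoly_alg_ind (fun f => swap (swap (swap (swap f))) = f)) => [||i g IH|i g IH].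
- split=> [|a g h E1 E2]; first by rewrite !linear0.
  by rewrite 4!swap_is_linear; congr (_ *: _ + _).
- by rewrite !swap1.
- by rewrite swapMu (linearN swap) /= swapMv (linearN swap) /= swapMu opprK swapMv IH.
- by rewrite swapMv swapMu (linearN swap) /= swapMv (linearN swap) /= swapMu opprK IH.
Qed.

Lemma swap_inj f : swap f = 0 -> f = 0.
Proof. by move=> f0; rewrite -[f]swap4 f0 !linear0. Qed.

Lemma swap_minor i j f : swap (minor C i j * f) = minor C i j * swap f.
Proof.
rewrite swapM; congr (_ * _).
rewrite /minor (linearB swap) /= !swapM (swap_u i) (swap_u j) (swap_v i) (swap_v j).
by rewrite !mulNr opprK addrC [v j * _]mulrC [v i * _]mulrC.
Qed.

Lemma swap_dminor i j f : swap (dminor i j f) = dminor i j (swap f).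
Proof.
rewrite /dminor (raddfB swap) /= (swap_du i) (swap_du j).
rewrite -(du_swap j) -(du_swap i) opprK addrC.
by rewrite (mderiv_comm (hi j) (lo i)) (mderiv_comm (hi i) (lo j)).
Qed.

Lemma swap_transfer i j f : swap (transfer i j f) = transfer i j (swap f).
Proof.
rewrite /transfer (linearD swap) /= (swapMu j) (swapMv j) (swap_du i).
by rewrite mulrN opprK -du_swap addrC.
Qed.

Lemma swap_eta f : swap (eta_op f) = Delta_op (swap f).
Proof.
rewrite /eta_op /Delta_op (linear_sum swap) -sumrN; apply: eq_bigr => i _ /=.
by rewrite swapMv swap_du mulrN.
Qed.

Lemma swap_Delta f : swap (Delta_op f) = eta_op (swap f).
Proof.
rewrite /eta_op /Delta_op (linearN swap) (linear_sum swap) -sumrN.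
by apply: eq_bigr => i _ /=; rewrite swapMu -du_swap opprK.
Qed.

Lemma Agr_swap k f : Agr k f -> Agr (- k) (swap f).
Proof.
move=> /AgrP; have sk := Agr_subspace C n (- k).
apply: (@supp_in_ind _ _ _ (fun f => Agr (- k) (swap f))) => [|m mk].
  split=> [|a g h gk hk]; first by rewrite linear0; exact: subspace0.
  by rewrite linearP; apply: subspaceD => //; apply: subspaceZ.
(* The degree is expressed through [m], since it changes along the induction on monomials. *)
suff: forall m, Agr ((udeg m)%:Z - (vdeg m)%:Z) (swap 'X_[m]).
  by move/(_ m); rewrite mk opprD addrA subrr add0r.
elim/mnm_ind => [|a m' IH].
  rewrite mpolyX0 swap1; apply/AgrP; rewrite -mpolyX0; apply: supp_inX.
  by rewrite /udeg /vdeg !big1 // => i _; rewrite mnm0E.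
rewrite mpolyXD -[a]splitK; case: (split a) => i /=.
  rewrite swapMu; apply: subspaceN; first exact: Agr_subspace.
  rewrite !degE (_ : _ - _ = (udeg m')%:Z - (vdeg m')%:Z + 1) ; last by lia.
  exact: Agr_mulv.
rewrite swapMv !degE (_ : _ - _ = (udeg m')%:Z - (vdeg m')%:Z - 1) ; last by lia.
exact: Agr_mulu.
Qed.

Definition unswap f := swap (swap (swap f)).

Lemma swapK f : unswap (swap f) = f. Proof. exact: swap4. Qed.
Lemma unswapK f : swap (unswap f) = f. Proof. exact: swap4. Qed.

Lemma unswap_is_linear : linear unswap.
Proof. by move=> a f g; rewrite /unswap !linearP. Qed.
HB.instance Definition _ := GRing.isLinear.Build C A A _ unswap unswap_is_linear.

HB.instance Definition _ := GRing.RMorphism.copy unswap (swap \o (swap \o swap)).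

Lemma Agr_unswap k f : Agr k f -> Agr (- k) (unswap f).
Proof. by move=> /Agr_swap/Agr_swap/Agr_swap; rewrite opprK. Qed.

Lemma Hgr_swap k f : Hgr' (- k) f -> Hgr k (swap f).
Proof.
by case=> /Agr_swap; rewrite opprK => fk f0; split=> //; rewrite -swap_eta f0 linear0.
Qed.

Lemma Hgr_unswap k f : Hgr k f -> Hgr' (- k) (unswap f).
Proof.
case=> fk f0; split; first exact: Agr_unswap.
by rewrite /unswap -swap_Delta -swap_eta -swap_Delta f0 !linear0.
Qed.

Lemma swap_submodule W : so_submodule T W -> so_submodule T (fun f => W (swap f)).
Proof.
move=> /so_submoduleP[sW Wt Wm Wd]; apply/so_submoduleP; split.
- split=> [|a f g Wf Wg]; first by rewrite linear0; exact: subspace0.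
  by rewrite linearP; apply: subspaceD => //; apply: subspaceZ.
- by move=> i j f Wf; rewrite swap_transfer; apply: Wt.
- by move=> i j f ij Wf; rewrite swap_minor; apply: Wm.
- by move=> i j f ij Wf; rewrite swap_dminor; apply: Wd.
Qed.

Lemma unswap_submodule W : so_submodule T W -> so_submodule T (fun f => W (unswap f)).
Proof. by move=> /swap_submodule/swap_submodule/swap_submodule. Qed.

Lemma Agr_direct_sum_neg k : k < 0 ->
  direct_sum (@Agr C n k) (@Hgr C n k) (image_of (@eta_op C n) (@Agr C n (k - 2))).
Proof.
move=> k0; have [|dsum duniq] := @Agr_direct_sum C n (- k); first by lia.
split=> [f|f fH [g [gk fE]]].
  split=> [fk|[x [w [[xk _] [g [gk ->]] ->]]]]; last first.
    apply: subspaceD => //; first exact: Agr_subspace.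
    by rewrite -[k](subrK 2); apply: Agr_eta.
  have [x [w [xH [g [gk wE]] fE]]] := (dsum _).1 (Agr_unswap fk).
  exists (swap x), (swap w); split.
  - exact: Hgr_swap.
  - exists (swap g); split; last by rewrite wE swap_Delta.
    by have := Agr_swap gk; rewrite opprD opprK.
  - by rewrite -linearD -fE /= unswapK.
have f0 : unswap f = 0.
  apply: duniq; first exact: Hgr_unswap.
  exists (unswap g); split; last by rewrite fE /unswap swap_eta swap_Delta swap_eta.
  by have := Agr_unswap gk; rewrite opprD opprK.
by rewrite -[f]unswapK f0 linear0.
Qed.

Lemma Hgr_of_unswap k f : Hgr' (- k) (unswap f) -> Hgr k f.
Proof. by move/Hgr_swap; rewrite unswapK. Qed.

(** [swap] commutes with the action and maps the kernel of [eta] in degree [- k] onto [Hgr k], so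
    submodules pull back to submodules. *)
Lemma Hgr_irreducible k : (1 < n)%N -> k < 0 -> irreducible_module T (@Hgr C n k).
Proof.
move=> hn k0; have [|sH [f [fH f0]] irr] := @Hgr'_irreducible C n hn (- k); first by lia.
split.
- have [[W0 WD] Wg] := unswap_submodule sH.
  split=> [|g h gso /Hgr_unswap hH]; last exact: (Hgr_of_unswap (Wg _ _ gso hH)).
  split=> [|a g h /Hgr_unswap gH /Hgr_unswap hH]; first exact: (Hgr_of_unswap W0).
  exact: (Hgr_of_unswap (WD _ _ _ gH hH)).
- by exists (swap f); split; [exact: Hgr_swap | move=> /swap_inj/f0].
move=> W sW WH; have [|Z|E] := irr _ (swap_submodule sW).
- by move=> g /WH/Hgr_unswap; rewrite swapK.
- left=> g Wg; have := Z (unswap g); rewrite unswapK => /(_ Wg) g0.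
  by rewrite -[g]unswapK g0 linear0.
- by right=> g /Hgr_unswap/E; rewrite unswapK.
Qed.

Lemma standard_monomials_morph (L : {rmorphism A -> A}) (z z' : 'I_n -> A) d f :
  (forall t, L (z t) = z' t) -> (forall i j, L (minor C i j) = minor C i j) ->
  standard_monomials z d f -> standard_monomials z' d (L f).
Proof.
move=> Lz Lm [kt [kk [ktd ktk kkk ->]]]; exists kt, kk; split=> //.
rewrite rmorphM !rmorph_prod; congr (_ * _).
  by apply: eq_bigr => t _; rewrite rmorphXn Lz.
apply: eq_bigr => i _; rewrite rmorph_prod; apply: eq_bigr => j _.
by rewrite rmorphXn /= Lm.
Qed.

(** Of the two maps it is [unswap] that sends [u t] to [v t] without a sign, so standard monomials
    correspond exactly, not only up to sign. *)
Lemma standard_monomials_unswap d f :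
  standard_monomials (fun t : 'I_n => u t) d f <->
  standard_monomials (fun t : 'I_n => v t) d (unswap f).
Proof.
have sm i j : swap (minor C i j) = minor C i j.
  by rewrite -[minor C i j]mulr1 swap_minor swap1.
split=> [|/(@standard_monomials_morph swap _ (fun t : 'I_n => u t))].
  apply: (@standard_monomials_morph unswap) => [t|i j]; last by rewrite /= /unswap !sm.
  by rewrite /= /unswap swap_u (linearN swap) /= swap_v (linearN swap) /= swap_u opprK.
by rewrite /= unswapK; apply=> [t|i j]; [exact: swap_v | exact: sm].
Qed.

Lemma Hgr_basis k : k < 0 ->
  is_basis (standard_monomials (fun t : 'I_n => u t) (- k)) (@Hgr C n k).
Proof.
move=> k0; have [d kE] : exists d : nat, - k = d by exists `|k|%N; lia.
have [spanv indv] := Hgr'_basis C n d; rewrite kE.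
have unswap_inj : injective unswap := can_inj unswapK.
split=> [f|s c us sX sum0 b bs].
  split=> [/Hgr_unswap|sp].
    rewrite kE => /(spanv _).1 sp; rewrite -[f]unswapK; move: (unswap f) sp.
    apply: lspan_sub => [|g gX]; last first.
      by apply: lspan_gen; apply/standard_monomials_unswap; rewrite swapK.
    have [l0 lD] := lspan_subspace (standard_monomials (fun t : 'I_n => u t) d).
    split=> [|a g h Wg Wh]; first by rewrite linear0.
    by rewrite swap_is_linear; apply: lD.
  apply: Hgr_of_unswap; rewrite kE; apply/(spanv _).2; move: f sp.
  apply: lspan_sub => [|g /standard_monomials_unswap gX]; last exact: lspan_gen.
  have [l0 lD] := lspan_subspace (standard_monomials (fun t : 'I_n => v t) d).
  split=> [|a g h Wg Wh]; first by rewrite linear0.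
  by rewrite unswap_is_linear; apply: lD.
(* A relation on [s] is carried to its image, with coefficients read back through [swap]. *)
rewrite -[b]unswapK; apply: (indv (map unswap s) (c \o swap)); last exact: map_f.
- by rewrite map_inj_uniq.
- by move=> _ /mapP[x /sX xX ->]; apply/standard_monomials_unswap.
transitivity (unswap (\sum_(x <- s) c x *: x)); last by rewrite sum0 linear0.
rewrite big_map (linear_sum unswap); apply: eq_bigr => x _ /=.
by rewrite unswapK linearZ.
Qed.

End Transport.

(** * Highest weight modules and the final assembly *)

Section HighestWeightModules.
Variables (C : numFieldType) (n : nat).
Hypothesis hn : (1 < n)%N.
Local Notation A := {mpoly C[n + n]}.
Local Notation lo i := (lshift n i).
Local Notation hi i := (rshift n i).
Local Notation u i := ('X_(lo i) : A).
Local Notation v i := ('X_(hi i) : A).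
Local Notation T := (Tlow n).
Local Notation last := (idx_last hn).

(** [so_generated] ranges over all submodules containing [f], including those not inside [M].
    Intersecting one with [M] gives a nonzero submodule of [M], hence all of [M]. *)
Lemma irreducible_highest_weight (M : A -> Prop) mu (f : A) :
  irreducible_module T M -> M f -> highest_weight_vector T mu f ->
  highest_weight_module T mu f M.
Proof.
move=> [sM _ irr] Mf hw; split=> // g; split=> [Mg W sW Wf|]; last by apply.
have [sub1 act1] := sM; have [sub2 act2] := sW.
have sWM : so_submodule T (fun h => W h /\ M h).
  split=> [|x h xso [Wh Mh]]; last by split; [apply: act2 | apply: act1].
  split=> [|a h h' [Wh Mh] [Wh' Mh']]; first by split; apply: subspace0.
  by split; [case: sub2 => _ | case: sub1 => _]; apply.
have [|Z|E] := irr _ sWM; first by move=> h [].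
  by case: hw => /(_ (Z f (conj Wf Mf))).
by case: (E g Mg).
Qed.

Lemma du_v_last d i : mderiv (lo i) (v last ^+ d) = 0.
Proof.
rewrite mpolyXn mderivX mulmnE mnm1E eq_rlshift mul0n.
exact: scale0r.
Qed.

Lemma dminor_v_last d i j : dminor i j (v last ^+ d) = 0.
Proof.
by rewrite /dminor mderiv_comm [X in _ - X]mderiv_comm !du_v_last !mderiv0 subrr.
Qed.

Lemma transfer_v_last_neq d i j : i != last -> transfer i j (v last ^+ d) = 0.
Proof.
move=> il; rewrite /transfer du_v_last mpolyXn mderivX mulmnE mnm1E.
by rewrite (inj_eq (@rshift_inj _ _)) eq_sym (negbTE il) mul0n scale0r !mulr0 addr0.
Qed.

Lemma transfer_v_last d i :
  transfer i i (v last ^+ d) = ((i == last)%:R * d%:R) *: v last ^+ d.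
Proof.
have [->|il] := eqVneq; last by rewrite transfer_v_last_neq // mul0r scale0r.
rewrite /transfer du_v_last mulr0 add0r mpolyXn mulX_mderivX mulmnE mnm1E eqxx.
by rewrite mul1n mul1r.
Qed.

Lemma neq_last (i j : 'I_n) : (i < j)%N -> i != last.
Proof. by rewrite -val_eqE /=; have := ltn_ord j; lia. Qed.

Lemma swap_v_last d : swap (v last ^+ d) = u last ^+ d.
Proof. by rewrite rmorphXn /= swap_v. Qed.

Lemma Hgr'_highest_weight k : 0 <= k ->
  highest_weight_module T
    (k%:~R *: fund_weight C (idx_penult hn) - (k + 2)%:~R *: fund_weight C last)
    (v last ^+ `|k|%N) (@Hgr' C n k).
Proof.
move=> k0; apply: irreducible_highest_weight.
- exact: Hgr'_irreducible.
- exact: v_last_Hgr'.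
apply: highest_weight_vectorP => [|i j _|i j ij|i].
- exact: v_last_neq0.
- exact: dminor_v_last.
- by apply: transfer_v_last_neq; apply: neq_last ij.
- by rewrite transfer_v_last [X in _ * X]pmulrn gez0_abs.
Qed.

Lemma Hgr_highest_weight k : k < 0 ->
  highest_weight_module T
    ((- k)%:~R *: fund_weight C (idx_penult hn) + (k - 2)%:~R *: fund_weight C last)
    (u last ^+ `|k|%N) (@Hgr C n k).
Proof.
move=> k0; apply: irreducible_highest_weight.
- exact: Hgr_irreducible.
- by rewrite -swap_v_last; apply: Hgr_swap; rewrite -abszN; apply: v_last_Hgr'; lia.
(* This puts the weight in the form of [highest_weight_vectorP] with [a = - k]. *)
have -> : (k - 2)%:~R *: fund_weight C last = - ((- k + 2)%:~R *: fund_weight C last).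
  by rewrite -scaleNr -mulrNz; congr (_%:~R *: _); lia.
apply: highest_weight_vectorP => [|i j _|i j ij|i].
- by apply/eqP; rewrite mpolyXn -msize_poly_eq0 msizeX.
- by rewrite -swap_v_last -swap_dminor dminor_v_last linear0.
- by rewrite -swap_v_last -swap_transfer transfer_v_last_neq ?linear0 // (neq_last ij).
- rewrite -swap_v_last -swap_transfer transfer_v_last linearZ /=.
  by rewrite [X in _ * X]pmulrn ltz0_abs.
Qed.

End HighestWeightModules.

Theorem theorem3p3 (R : realType) (n : nat) (hn : (1 < n)%N) (k : int) :
  (0 <= k ->
    [/\ direct_sum (@Agr R[i] n k) (@Hgr' R[i] n k)
          (image_of (@Delta_op R[i] n) (@Agr R[i] n (k + 2))),
        irreducible_module (Tlow n) (@Hgr' R[i] n k),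
        highest_weight_module (Tlow n)
          (k%:~R *: fund_weight R[i] (idx_penult hn)
           - (k + 2)%:~R *: fund_weight R[i] (idx_last hn))
          ('X_(rshift n (idx_last hn)) ^+ `|k|%N) (@Hgr' R[i] n k) &
        is_basis
          (standard_monomials (fun t : 'I_n => 'X_(rshift n t)) k)
          (@Hgr' R[i] n k)])
  /\
  (k < 0 ->
    [/\ direct_sum (@Agr R[i] n k) (@Hgr R[i] n k)
          (image_of (@eta_op R[i] n) (@Agr R[i] n (k - 2))),
        irreducible_module (Tlow n) (@Hgr R[i] n k),
        highest_weight_module (Tlow n)
          ((- k)%:~R *: fund_weight R[i] (idx_penult hn)
           + (k - 2)%:~R *: fund_weight R[i] (idx_last hn))
          ('X_(lshift n (idx_last hn)) ^+ `|k|%N) (@Hgr R[i] n k) &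
        is_basis
          (standard_monomials (fun t : 'I_n => 'X_(lshift n t)) (- k))
          (@Hgr R[i] n k)]).
Proof.
split=> k0; split.
- exact: Agr_direct_sum.
- exact: Hgr'_irreducible.
- exact: Hgr'_highest_weight.
- by move: k0; case: k => // d _; apply: Hgr'_basis.
- exact: Agr_direct_sum_neg.
- exact: Hgr_irreducible.
- exact: Hgr_highest_weight.
- exact: Hgr_basis.
Qed.
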